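(* Let $A$, $B$ be two locally indicable groups and let $G:=(A\ast B)\times C$ for a group $C$. Let $w\in G$ be an element that is neither conjugate in $G$ to an element of $A\times C$ nor to an element of $B\times C$. Define $N:=\langle\langle w\rangle\rangle_G\cap C$ and $\widetilde{C}:=C/N$. Then $A\times\widetilde{C}$ canonically embeds into $G/\langle\langle w\rangle\rangle_G$.
   Context: $\langle\langle w\rangle\rangle_G$ denotes the normal closure of $w$ in $G$. A group is locally indicable if each of its non-trivial finitely generated subgroups admits an epimorphism onto $\mathbb{Z}$. The group $C$ is identified with the direct factor $\{1\}\times C$ of $G$. ''Canonically embeds'' means that the homomorphism $A\times\widetilde{C}\to G/\langle\langle w\rangle\rangle_G$ induced by the inclusion $A\times C\subseteq G$ is (well defined and) injective. *)

(* Defs.v *)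
From HB Require Import structures.
From mathcomp Require Import all_boot ssralg ssrint.
From mathcomp Require Import boolp classical_sets.

Set Implicit Arguments.
Unset Strict Implicit.
Unset Printing Implicit Defensive.

Import GRing.Theory.

Local Open Scope classical_set_scope.
Local Open Scope quotient_scope.
Local Open Scope group_scope.

Definition subgroup (G : groupType) (H : set G) : Prop :=
  H 1 /\ forall x y, H x -> H y -> H (x / y).

Definition finitely_generated (G : groupType) (H : set G) : Prop :=
  exists s : seq G, H = smallest (@subgroup G) [set` s].

(* A homomorphism H -> Z is represented by a function on all of G that is
   only required to be additive on H; its values outside H are irrelevant. *)
Definition locally_indicable (G : groupType) : Prop :=
  forall H : set G, subgroup H -> finitely_generated H -> H <> [set 1] ->
    exists f : G -> int,
      (forall x y, H x -> H y -> f (x * y) = (f x + f y)%R) /\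
      f @` H = [set: int].

Definition normal_subset (G : groupType) (H : set G) : Prop :=
  subgroup H /\ forall x y, H x -> H (x ^ y).

Record normalSubgroup (G : groupType) := NormalSubgroup {
  nsub_set :> set G;
  nsub_normal : normal_subset nsub_set }.

Section NormalClosure.
Variable G : groupType.

Lemma smallest_normal (S : set G) : normal_subset (smallest (@normal_subset G) S).
Proof.
split; first split.
- by move=> H [[[]]].
- move=> x y Sx Sy H HH.
  by have [[[_ HF] _] _] := HH; apply: HF; [apply: Sx | apply: Sy].
- move=> x y Sx H HH.
  by have [[_ HJ] _] := HH; apply: HJ; apply: Sx.
Qed.

Definition normal_closure (w : G) : normalSubgroup G :=
  NormalSubgroup (smallest_normal [set w]).

End NormalClosure.

Section Preimage.
Variables (G H : groupType) (f : UMagmaMorphism.type G H).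
Variable N : normalSubgroup H.

Lemma preimage_normal : normal_subset (f @^-1` N).
Proof.
have [[N1 NF] NJ] := nsub_normal N; split; first split.
- by rewrite /preimage /= gmulf1.
- by move=> x y Nx Ny; rewrite /preimage /= gmulfF; apply: NF.
- by move=> x y Nx; rewrite /preimage /= gmulfJ; apply: NJ.
Qed.

Definition nsub_preimage : normalSubgroup G := NormalSubgroup preimage_normal.

End Preimage.

Section QuotientGroup.
Variables (G : groupType) (N : normalSubgroup G).

Definition coset_rel (x y : G) : bool := `[< nsub_set N (x^-1 * y) >].

Let N1 : nsub_set N 1. Proof. by have [[]] := nsub_normal N. Qed.
Let NF x y : nsub_set N x -> nsub_set N y -> nsub_set N (x / y).
Proof. by have [[_ h] _] := nsub_normal N; apply: h. Qed.
Let NJ x y : nsub_set N x -> nsub_set N (x ^ y).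
Proof. by have [_ h] := nsub_normal N; apply: h. Qed.
Let NV x : nsub_set N x -> nsub_set N x^-1. Proof. by move=> /(NF N1); rewrite div1g. Qed.
Let NM x y : nsub_set N x -> nsub_set N y -> nsub_set N (x * y).
Proof. by move=> Nx /NV /(NF Nx); rewrite invgK. Qed.

Lemma coset_rel_refl : reflexive coset_rel.
Proof. by move=> x; apply/asboolP; rewrite mulVg. Qed.

Lemma coset_rel_sym : symmetric coset_rel.
Proof.
move=> x y; apply/asboolP/asboolP => /NV; by rewrite invgM invgK.
Qed.

Lemma coset_rel_trans : transitive coset_rel.
Proof.
move=> y x z /asboolP h1 /asboolP h2; apply/asboolP.
by move: (NM h1 h2); rewrite mulgA mulgK.
Qed.

Canonical coset_equiv :=
  EquivRel coset_rel coset_rel_refl coset_rel_sym coset_rel_trans.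

Definition quotient_group : Type := {eq_quot coset_equiv}.

HB.instance Definition _ := Choice.on quotient_group.
HB.instance Definition _ := EqQuotient.on quotient_group.

Definition quot_proj (x : G) : quotient_group := \pi_quotient_group x.

Lemma quot_projP x y : quot_proj x = quot_proj y <-> nsub_set N (x^-1 * y).
Proof.
by split=> [/eqquotP/asboolP | h]; last by apply/eqquotP/asboolP.
Qed.

Lemma quot_proj_surj (u : quotient_group) : exists x, quot_proj x = u.
Proof. by exists (repr u); rewrite /quot_proj reprK. Qed.

Lemma quot_projK (u : quotient_group) : quot_proj (repr u) = u.
Proof. by rewrite /quot_proj reprK. Qed.

Definition quot_mul (u v : quotient_group) := quot_proj (repr u * repr v).
Definition quot_inv (u : quotient_group) := quot_proj (repr u)^-1.

Lemma quot_mulE x y : quot_mul (quot_proj x) (quot_proj y) = quot_proj (x * y).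
Proof.
apply/quot_projP; set x' := repr _; set y' := repr _.
have /quot_projP Nx : quot_proj x' = quot_proj x by exact: quot_projK.
have /quot_projP Ny : quot_proj y' = quot_proj y by exact: quot_projK.
have := NM (NJ y' Nx) Ny; congr (nsub_set _ _).
by rewrite /conjg invgM !mulgA mulgK.
Qed.

Lemma quot_invE x : quot_inv (quot_proj x) = quot_proj x^-1.
Proof.
apply/quot_projP; set x' := repr _.
have /quot_projP Nx : quot_proj x = quot_proj x' by rewrite quot_projK.
have := NJ (x^-1) Nx; congr (nsub_set _ _).
by rewrite /conjg !invgK !mulgA mulgV mul1g.
Qed.

Lemma quot_mulA : associative quot_mul.
Proof.
move=> u v t; rewrite -(quot_projK u) -(quot_projK v) -(quot_projK t).
by rewrite !quot_mulE mulgA.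
Qed.

Lemma quot_mul1 : left_id (quot_proj 1) quot_mul.
Proof. by move=> u; rewrite -(quot_projK u) quot_mulE mul1g. Qed.

Lemma quot_mulr1 : right_id (quot_proj 1) quot_mul.
Proof. by move=> u; rewrite -(quot_projK u) quot_mulE mulg1. Qed.

Lemma quot_mulV : left_inverse (quot_proj 1) quot_inv quot_mul.
Proof.
by move=> u; rewrite -(quot_projK u) quot_invE quot_mulE mulVg.
Qed.

Lemma quot_mulrV : right_inverse (quot_proj 1) quot_inv quot_mul.
Proof.
by move=> u; rewrite -(quot_projK u) quot_invE quot_mulE mulgV.
Qed.

HB.instance Definition _ := isGroup.Build quotient_group
  quot_mulA quot_mul1 quot_mulr1 quot_mulV quot_mulrV.

Lemma quot_proj_is_morphism : monoid.monoid_morphism quot_proj.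
Proof. by split=> // x y; rewrite -quot_mulE. Qed.

HB.instance Definition _ :=
  isUMagmaMorphism.Build G quotient_group quot_proj quot_proj_is_morphism.

End QuotientGroup.

Section PairInjection.
Variables G H : groupType.

Definition pair_inr (h : H) : G * H := (1, h).

Lemma pair_inr_is_morphism : monoid.monoid_morphism pair_inr.
Proof. by split=> // x y; congr (_, _); rewrite mulg1. Qed.

HB.instance Definition _ :=
  isUMagmaMorphism.Build H (G * H)%type pair_inr pair_inr_is_morphism.

End PairInjection.

Arguments pair_inr {G H} h.

(* The free product of A and B, as the group of reduced words: finite sequences
   of non-trivial elements coming alternately from A and from B.  The product
   is concatenation followed by reduction. *)
Section FreeProduct.
Variables A B : groupType.

Definition same_factor (x y : A + B) : bool :=
  match x, y with inl _, inl _ | inr _, inr _ => true | _, _ => false end.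

Definition letter_neq1 (x : A + B) : bool :=
  match x with inl a => a != 1 | inr b => b != 1 end.

Definition letter_inv (x : A + B) : A + B :=
  match x with inl a => inl a^-1 | inr b => inr b^-1 end.

Definition reduced (s : seq (A + B)) : bool :=
  all letter_neq1 s && sorted (fun x y => ~~ same_factor x y) s.

Definition reduce (s : seq (A + B)) : seq (A + B) :=
  if s is x :: s' then if letter_neq1 x then s else s' else [::].

(* The reduced form of x :: s, for s reduced. *)
Definition fp_cons (x : A + B) (s : seq (A + B)) : seq (A + B) :=
  match x, s with
  | inl a, inl a' :: s' => reduce (inl (a * a') :: s')
  | inr b, inr b' :: s' => reduce (inr (b * b') :: s')
  | _, _ => reduce (x :: s)
  end.

Record free_product := FreeProduct {
  fp_word :> seq (A + B);
  fp_reduced : reduced fp_word }.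

HB.instance Definition _ := [isSub for fp_word].
HB.instance Definition _ := [Choice of free_product by <:].

Lemma reduced_behead x s : reduced (x :: s) -> reduced s.
Proof. by case/andP=> /= /andP[_ h] /path_sorted ps; apply/andP. Qed.

Lemma fp_cons_reduced x s : reduced s -> reduced (fp_cons x s).
Proof.
move=> rs; have := rs.
case: x => [a|b]; case: s rs => [|[a'|b'] s] rs /andP[] /=;
  rewrite /reduce /=; try (by case: ifP => // e; rewrite /reduced /= ?e);
  move=> /andP[h1 h2] h3; case: ifP => e; rewrite /reduced /= ?e ?h1 ?h2 ?(path_sorted h3) //=;
  by case: s h3 {rs h2} => // -[].
Qed.

Lemma foldr_fp_cons_reduced s t :
  reduced t -> reduced (foldr fp_cons t s).
Proof. by move=> rt; elim: s => //= x s; apply: fp_cons_reduced. Qed.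

Lemma fp_cons_inl1 s : reduced s -> fp_cons (inl 1) s = s.
Proof.
case: s => [|[a|b] s] /=; rewrite ?eqxx // mul1g.
by case/andP=> /= /andP[-> _].
Qed.

Lemma fp_cons_inr1 s : reduced s -> fp_cons (inr 1) s = s.
Proof.
case: s => [|[a|b] s] /=; rewrite ?eqxx // mul1g.
by case/andP=> /= /andP[-> _].
Qed.

Lemma fp_cons_inlM a a' s : reduced s ->
  fp_cons (inl (a * a')) s = fp_cons (inl a) (fp_cons (inl a') s).
Proof.
case: s => [|[c|b] s] rs /=.
- by case: (eqVneq a' 1) => [->|] /=; rewrite ?mulg1.
- rewrite -mulgA; case: (eqVneq (a' * c) 1) => [->|] //=.
  rewrite mulg1.
  by case: s rs => [|[d|d] s] //= /andP[_] /=.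
- by case: (eqVneq a' 1) => [->|] /=; rewrite ?mulg1.
Qed.

Lemma fp_cons_inrM b b' s : reduced s ->
  fp_cons (inr (b * b')) s = fp_cons (inr b) (fp_cons (inr b') s).
Proof.
case: s => [|[a|c] s] rs /=.
- by case: (eqVneq b' 1) => [->|] /=; rewrite ?mulg1.
- by case: (eqVneq b' 1) => [->|] /=; rewrite ?mulg1.
- rewrite -mulgA; case: (eqVneq (b' * c) 1) => [->|] //=.
  rewrite mulg1.
  by case: s rs => [|[d|d] s] //= /andP[_] /=.
Qed.

Local Arguments fp_cons : simpl never.

Lemma foldr_fp_cons x s u : reduced s -> reduced u ->
  foldr fp_cons u (fp_cons x s) = fp_cons x (foldr fp_cons u s).
Proof.
move=> rs ru.
have red y t : foldr fp_cons u (reduce (y :: t)) = fp_cons y (foldr fp_cons u t).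
  have rt := foldr_fp_cons_reduced t ru.
  rewrite /reduce; case: y => [a|b] /=.
    by case: eqVneq => [->|] //=; rewrite fp_cons_inl1.
  by case: eqVneq => [->|] //=; rewrite fp_cons_inr1.
case: x => [a|b]; case: s rs => [|[a'|b'] s] rs; rewrite [fp_cons _ _ in LHS]/fp_cons red //=.
- by rewrite fp_cons_inlM //; apply: foldr_fp_cons_reduced.
- by rewrite fp_cons_inrM //; apply: foldr_fp_cons_reduced.
Qed.

Lemma foldr_fp_consA s t u : reduced t -> reduced u ->
  foldr fp_cons u (foldr fp_cons t s) = foldr fp_cons (foldr fp_cons u t) s.
Proof.
move=> rt ru; elim: s => //= x s <-.
by rewrite foldr_fp_cons //; apply: foldr_fp_cons_reduced.
Qed.

Lemma foldr_fp_cons_nil s : reduced s -> foldr fp_cons [::] s = s.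
Proof.
elim: s => //= x s IH rs; rewrite IH ?(reduced_behead rs) //.
case: x rs => [a|b] /andP[/= /andP[h _]]; case: s {IH} => [|[a'|b'] s] //=; by rewrite /fp_cons /= h.
Qed.

Lemma letter_invK : involutive letter_inv.
Proof. by case=> x /=; rewrite invgK. Qed.

Definition word_inv (s : seq (A + B)) := rev (map letter_inv s).

Lemma word_invK : involutive word_inv.
Proof.
by move=> s; rewrite /word_inv map_rev revK -map_comp map_id_in // => x _ /=; rewrite letter_invK.
Qed.

Lemma word_inv_reduced s : reduced s -> reduced (word_inv s).
Proof.
case/andP=> h1 h2; apply/andP; split.
  rewrite all_rev all_map; apply: sub_all h1 => -[] x /=; by rewrite invg_eq1.
rewrite rev_sorted sorted_map; apply: sub_sorted h2 => -[] x [] y //=.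
Qed.

Lemma fp_consKV x s : reduced s -> fp_cons x (fp_cons (letter_inv x) s) = s.
Proof.
move=> rs; case: x => x /=.
  by rewrite -fp_cons_inlM // mulgV fp_cons_inl1.
by rewrite -fp_cons_inrM // mulgV fp_cons_inr1.
Qed.

Lemma foldr_word_invK s t : reduced t ->
  foldr fp_cons (foldr fp_cons t (word_inv s)) s = t.
Proof.
elim: s t => //= x s IH t rt.
rewrite /word_inv /= rev_cons -cats1 foldr_cat /= IH; last exact: fp_cons_reduced.
exact: fp_consKV.
Qed.

Definition fp_one : free_product := @FreeProduct [::] isT.
Definition fp_mul (s t : free_product) : free_product :=
  FreeProduct (foldr_fp_cons_reduced s (fp_reduced t)).
Definition fp_inv (s : free_product) : free_product :=
  FreeProduct (word_inv_reduced (fp_reduced s)).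

Lemma fp_mulA : associative fp_mul.
Proof.
move=> s t u; apply: val_inj => /=.
by rewrite foldr_fp_consA //; apply: fp_reduced.
Qed.

Lemma fp_mul1 : left_id fp_one fp_mul.
Proof. by move=> s; apply: val_inj. Qed.

Lemma fp_mulr1 : right_id fp_one fp_mul.
Proof. by move=> s; apply: val_inj => /=; rewrite foldr_fp_cons_nil ?fp_reduced. Qed.

Lemma fp_mulrV : right_inverse fp_one fp_inv fp_mul.
Proof.
move=> s; apply: val_inj => /=.
have := @foldr_word_invK s [::] isT.
by rewrite (@foldr_fp_cons_nil (word_inv s)) // word_inv_reduced // fp_reduced.
Qed.

Lemma fp_mulV : left_inverse fp_one fp_inv fp_mul.
Proof.
move=> s; have := fp_mulrV (fp_inv s); congr (fp_mul _ _ = _).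
by apply: val_inj => /=; rewrite word_invK.
Qed.

HB.instance Definition _ := isGroup.Build free_product
  fp_mulA fp_mul1 fp_mulr1 fp_mulV fp_mulrV.

Lemma reduce1_reduced x : reduced (reduce [:: x]).
Proof. by rewrite /reduce; case: ifP => // h; rewrite /reduced /= h. Qed.

Definition fp_inl (a : A) : free_product := FreeProduct (reduce1_reduced (inl a)).
Definition fp_inr (b : B) : free_product := FreeProduct (reduce1_reduced (inr b)).

Lemma fp_inlE a (s : free_product) : fp_inl a * s = fp_cons (inl a) s :> seq _.
Proof.
rewrite /= /mul /= /reduce /=; case: eqVneq => [->|] //=.
by rewrite fp_cons_inl1 ?fp_reduced.
Qed.

Lemma fp_inrE b (s : free_product) : fp_inr b * s = fp_cons (inr b) s :> seq _.
Proof.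
rewrite /= /mul /= /reduce /=; case: eqVneq => [->|] //=.
by rewrite fp_cons_inr1 ?fp_reduced.
Qed.

Lemma fp_inl_is_morphism : monoid.monoid_morphism fp_inl.
Proof.
split=> [|x y]; apply: val_inj; first by rewrite /= eqxx.
by rewrite [RHS](fp_inlE x (fp_inl y)) -[RHS](@fp_cons_inlM x y [::] isT).
Qed.

Lemma fp_inr_is_morphism : monoid.monoid_morphism fp_inr.
Proof.
split=> [|x y]; apply: val_inj; first by rewrite /= eqxx.
by rewrite [RHS](fp_inrE x (fp_inr y)) -[RHS](@fp_cons_inrM x y [::] isT).
Qed.

HB.instance Definition _ :=
  isUMagmaMorphism.Build A free_product fp_inl fp_inl_is_morphism.
HB.instance Definition _ :=
  isUMagmaMorphism.Build B free_product fp_inr fp_inr_is_morphism.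

Lemma fp_cons_ind (P : free_product -> Prop) :
  P 1 -> (forall a s, P s -> P (fp_inl a * s)) ->
  (forall b s, P s -> P (fp_inr b * s)) -> forall s, P s.
Proof.
move=> P1 Pl Pr [s]; elim: s => [|x s IH] rs.
  by have -> : FreeProduct rs = 1 by apply: val_inj.
have rs' := reduced_behead rs.
have E : fp_cons x s = x :: s.
  by have := foldr_fp_cons_nil rs; rewrite /= foldr_fp_cons_nil.
case: x rs E => x rs E.
  have -> : FreeProduct rs = fp_inl x * FreeProduct rs'.
    by apply: val_inj; rewrite [RHS]fp_inlE /= E.
  exact: Pl.
have -> : FreeProduct rs = fp_inr x * FreeProduct rs'.
  by apply: val_inj; rewrite [RHS]fp_inrE /= E.
exact: Pr.
Qed.

End FreeProduct.

Arguments fp_inl {A B} a.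
Arguments fp_inr {A B} b.

Section FreeProductUniversal.
Variables A B H : groupType.
Variables (f : UMagmaMorphism.type A H) (g : UMagmaMorphism.type B H).

Definition letter_lift (x : A + B) : H :=
  match x with inl a => f a | inr b => g b end.

Definition fp_lift (s : free_product A B) : H :=
  foldr (fun x h => letter_lift x * h) 1 s.

Lemma fp_lift_inlM a s : fp_lift (fp_inl a * s) = f a * fp_lift s.
Proof.
have fM x y : f x * f y = f (x * y) by rewrite gmulfM.
rewrite /fp_lift fp_inlE; move: (fp_word s) => {}s; rewrite /fp_cons.
case: s => [|[c|c] s]; rewrite /reduce /=;
  case: eqVneq => [e|_] //=; rewrite ?mulgA ?fM ?e ?gmulf1 ?mul1g //.
Qed.

Lemma fp_lift_inrM b s : fp_lift (fp_inr b * s) = g b * fp_lift s.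
Proof.
have gM x y : g x * g y = g (x * y) by rewrite gmulfM.
rewrite /fp_lift fp_inrE; move: (fp_word s) => {}s; rewrite /fp_cons.
case: s => [|[c|c] s]; rewrite /reduce /=;
  case: eqVneq => [e|_] //=; rewrite ?mulgA ?gM ?e ?gmulf1 ?mul1g //.
Qed.

Lemma fp_lift_is_morphism : monoid.monoid_morphism fp_lift.
Proof.
split=> // s t; elim/fp_cons_ind: s => [|a s IH|b s IH].
- by rewrite !mul1g.
- by rewrite -mulgA !fp_lift_inlM IH mulgA.
- by rewrite -mulgA !fp_lift_inrM IH mulgA.
Qed.

HB.instance Definition _ :=
  isUMagmaMorphism.Build (free_product A B) H fp_lift fp_lift_is_morphism.

Lemma fp_lift_inl a : fp_lift (fp_inl a) = f a.
Proof. by rewrite -[fp_inl a]mulg1 fp_lift_inlM mulg1. Qed.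

Lemma fp_lift_inr b : fp_lift (fp_inr b) = g b.
Proof. by rewrite -[fp_inr b]mulg1 fp_lift_inrM mulg1. Qed.

Lemma fp_lift_unique (h : UMagmaMorphism.type (free_product A B) H) :
  (forall a, h (fp_inl a) = f a) -> (forall b, h (fp_inr b) = g b) ->
  h =1 fp_lift.
Proof.
move=> hl hr; elim/fp_cons_ind => [|a s IH|b s IH].
- by rewrite gmulf1.
- by rewrite gmulfM hl IH fp_lift_inlM.
- by rewrite gmulfM hr IH fp_lift_inrM.
Qed.

End FreeProductUniversal.

(* Main.v *)
(* Write [w = (u, c)]. An element [(a, x)] of the normal closure of [w] has [a] in the normal
   closure of [u] in [A * B], so everything follows from the Freiheitssatz for locally
   indicable groups: [A] embeds in the quotient of [A * B] by [u] (Brodskii, Howie).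
   After conjugation [u] is an alternating product of non-trivial [a_i] and [b_i], and
   [prod a_i t b_i t^-1 = 1] is an equation in [t] over [A x B]. So it suffices that every
   cyclically reduced equation [w(t) = 1] over a locally indicable group [C] has a solution
   in an overgroup of [C]. This is a Magnus induction on the number of occurrences of [t].
   After a substitution for [t], there is a homomorphism from the coefficients and [t] to
   the integers that kills [w] and under which the occurrences of [t] do not all lift to
   the same edge of the corresponding infinite cyclic cover. The lift of [w] is then an
   equation in several unknowns [t_i], each occurring less often; for the first and the
   last unknown it is solvable by induction over the free product of [C] and the free group
   on the other ones. These solutions, and their translates, are glued as amalgamated
   products, and a wreath product with the integers brings the result back to [C]. *)
Require Import Defs.
From HB Require Import structures.
From mathcomp Require Import all_boot order ssralg ssrnum ssrint.
From mathcomp Require Import boolp classical_sets.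
From mathcomp Require Import zify.

Set Implicit Arguments.
Unset Strict Implicit.
Unset Printing Implicit Defensive.

Import Order.TTheory GRing.Theory Num.Theory.
Local Open Scope group_scope.

(** * Groups of bijections, amalgams and wreath products *)

Definition hom (G H : groupType) (f : G -> H) := forall x y, f (x * y) = f x * f y.

Section Homomorphisms.
Variables (G H : groupType) (f : G -> H).
Hypothesis fM : hom f.

Lemma hom1 : f 1 = 1.
Proof. by apply: (mulIg (f 1)); rewrite -fM !mul1g. Qed.

Lemma homV x : f x^-1 = (f x)^-1.
Proof. by apply: (mulIg (f x)); rewrite -fM !mulVg hom1. Qed.

Lemma hom_inj : (forall x, f x = 1 -> x = 1) -> injective f.
Proof.
move=> f1 x y e; apply: divg1_eq; apply: f1.
by rewrite fM homV e mulgV.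
Qed.

End Homomorphisms.

Section SubgroupType.
Variables (G : groupType) (H : set G) (sH : subgroup H).

Record subgroup_elt := Subgroup { sg_val : G; sg_prop : H sg_val }.

Definition subgroup_type of subgroup H := subgroup_elt.
Local Notation sgT := (subgroup_type sH).

HB.instance Definition _ := gen_eqMixin sgT.
HB.instance Definition _ := gen_choiceMixin sgT.

Lemma sg_val_inj : injective sg_val.
Proof. by case=> x p [y q] /= e; subst y; congr Subgroup; apply: Prop_irrelevance. Qed.

Lemma subgroup1 : H 1. Proof. by case: sH. Qed.
Lemma subgroupV x : H x -> H x^-1.
Proof. by case: sH => h1 hF hx; rewrite -div1g; apply: hF. Qed.
Lemma subgroupM x y : H x -> H y -> H (x * y).
Proof. by case: sH => h1 hF hx hy; rewrite -[y]invgK; apply: hF (subgroupV hy). Qed.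

Definition sg_one : sgT := Subgroup subgroup1.
Definition sg_inv (x : sgT) : sgT := Subgroup (subgroupV (sg_prop x)).
Definition sg_mul (x y : sgT) : sgT := Subgroup (subgroupM (sg_prop x) (sg_prop y)).

Fact sg_mulA : associative sg_mul.
Proof. by move=> x y z; apply: sg_val_inj; apply: mulgA. Qed.
Fact sg_mul1g : left_id sg_one sg_mul.
Proof. by move=> x; apply: sg_val_inj; apply: mul1g. Qed.
Fact sg_mulg1 : right_id sg_one sg_mul.
Proof. by move=> x; apply: sg_val_inj; apply: mulg1. Qed.
Fact sg_mulVg : left_inverse sg_one sg_inv sg_mul.
Proof. by move=> x; apply: sg_val_inj; apply: mulVg. Qed.
Fact sg_mulgV : right_inverse sg_one sg_inv sg_mul.
Proof. by move=> x; apply: sg_val_inj; apply: mulgV. Qed.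

HB.instance Definition _ := isGroup.Build sgT
  sg_mulA sg_mul1g sg_mulg1 sg_mulVg sg_mulgV.

Lemma sg_valM : hom (sg_val : sgT -> G). Proof. by []. Qed.

End SubgroupType.

Section BijectionGroup.
Variable T : Type.

Record bijection := Bijection {
  bij_fun :> T -> T; bij_inv : T -> T;
  bij_funK : cancel bij_fun bij_inv; bij_invK : cancel bij_inv bij_fun }.

HB.instance Definition _ := gen_eqMixin bijection.
HB.instance Definition _ := gen_choiceMixin bijection.

Lemma bijectionP (f g : bijection) : (forall x, f x = g x) -> f = g.
Proof.
case: f g => f f' fK f'K [g g' gK g'K] /= e.
have {}e : f = g by apply/funext.
subst g; have e : f' = g' by apply/funext => x; rewrite -[x in LHS]g'K fK.
by subst g'; congr Bijection; apply: Prop_irrelevance.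
Qed.

Definition bij_one : bijection := @Bijection id id (fun=> erefl) (fun=> erefl).
Definition bij_mul (f g : bijection) : bijection :=
  Bijection (can_comp (bij_funK f) (bij_funK g)) (can_comp (bij_invK g) (bij_invK f)).
Definition bij_V (f : bijection) : bijection := Bijection (bij_invK f) (bij_funK f).

Fact bij_mulA : associative bij_mul. Proof. by move=> f g h; apply: bijectionP. Qed.
Fact bij_mul1g : left_id bij_one bij_mul. Proof. by move=> f; apply: bijectionP. Qed.
Fact bij_mulg1 : right_id bij_one bij_mul. Proof. by move=> f; apply: bijectionP. Qed.
Fact bij_mulVg : left_inverse bij_one bij_V bij_mul.
Proof. by move=> f; apply: bijectionP => x; apply: bij_funK. Qed.
Fact bij_mulgV : right_inverse bij_one bij_V bij_mul.
Proof. by move=> f; apply: bijectionP => x; apply: bij_invK. Qed.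

HB.instance Definition _ := isGroup.Build bijection
  bij_mulA bij_mul1g bij_mulg1 bij_mulVg bij_mulgV.

Lemma bij_mulE (f g : bijection) x : (f * g) x = f (g x). Proof. by []. Qed.

Section Action.
Variables (G : groupType) (act : G -> T -> T).
Hypotheses (act1 : forall x, act 1 x = x) (actM : forall a b x, act (a * b) x = act a (act b x)).

Lemma actK a : cancel (act a) (act a^-1). Proof. by move=> x; rewrite -actM mulVg. Qed.
Lemma actVK a : cancel (act a^-1) (act a). Proof. by move=> x; rewrite -actM mulgV. Qed.

Definition act_bij (a : G) : bijection := Bijection (actK a) (actVK a).

Lemma act_bijM : hom act_bij.
Proof. by move=> a b; apply: bijectionP => x; apply: actM. Qed.

End Action.
End BijectionGroup.

(** * Amalgams as groups of permutations *)

Section Amalgam.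
Variables (V X : groupType) (i : V -> X).
Hypotheses (iM : hom i) (i_inj : injective i).

Lemma equivariant_retraction : exists r : X -> V, forall v x, r (i v * x) = v * r x.
Proof.
pose R (x y : X) : Prop := exists v, y = i v * x.
have Rrefl x : R x x by exists 1; rewrite (hom1 iM) mul1g.
have RE v x : R (i v * x) = R x.
  apply/funext => y; apply/propext; split=> -[u ->].
    by exists (u * v); rewrite iM mulgA.
  by exists (u * v^-1); rewrite iM (homV iM) !mulgA mulgVK.
(* The representative is chosen from the coset as a set, so it depends only on the coset; [r] is the
   [V]-component relative to it. *)
have /choice[pick pickP] (S : set X) : exists x, (exists y, S y) -> S x.
  by have [[y Sy]|nS] := pselect (exists y, S y); [exists y | exists 1].
pose rep x := pick (R x).
have repE v x : rep (i v * x) = rep x by rewrite /rep RE.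
have /choice[r rP] x : exists v, x = i v * rep x.
  have [v e] : R x (rep x) by apply: pickP; exists x.
  by exists v^-1; rewrite e (homV iM) mulKg.
exists r => v x; apply: i_inj.
apply: (mulIg (rep x)); rewrite -[in LHS](repE v x) -rP iM -mulgA; congr (_ * _).
exact: rP.
Qed.

End Amalgam.

(* Both factors act on [X * X']: [x] multiplies the first coordinate on the left and
   the second one by the resulting change of the [V]-component; symmetrically for [X'].
   On [V] the two actions are the diagonal one. *)
Lemma amalgam_act (V X X' : groupType) (i : V -> X) (i' : V -> X') (r : X -> V) :
  hom i -> hom i' -> (forall v x, r (i v * x) = v * r x) ->
  exists a : X -> bijection (X * X'),
    [/\ hom a, injective a & forall v y, a (i v) y = (i v * y.1, i' v * y.2)].
Proof.
move=> iM i'M rE.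
pose act x (y : X * X') := (x * y.1, i' (r (x * y.1) / r y.1) * y.2).
have act1 y : act 1 y = y by case: y => y y'; rewrite /act /= mul1g mulgV (hom1 i'M) mul1g.
have actM a b y : act (a * b) y = act a (act b y).
  by case: y => y y'; rewrite /act /= (mulgA (i' _) (i' _)) -i'M !mulgA mulgVK.
exists (act_bij act1 actM); split; first exact: act_bijM.
  by move=> a b /(congr1 (fun f : bijection _ => (f (1, 1)).1)); rewrite /= !mulg1.
by move=> v y; rewrite /= /act rE mulgK.
Qed.

(** Both factors embed in the permutations of [X * X']; the second action is [amalgam_act] with the
    roles exchanged, conjugated by the swap [sw]. *)
Lemma amalgam_exists (V X X' : groupType) (i : V -> X) (i' : V -> X') :
  hom i -> injective i -> hom i' -> injective i' ->
  exists (Z : groupType) (a : X -> Z) (a' : X' -> Z),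
    [/\ hom a, injective a, hom a', injective a' & forall v, a (i v) = a' (i' v)].
Proof.
move=> iM i_inj i'M i'_inj.
have [r rE] := equivariant_retraction iM i_inj.
have [r' r'E] := equivariant_retraction i'M i'_inj.
have [a [aM a_inj aE]] := amalgam_act iM i'M rE.
have [b [bM b_inj bE]] := amalgam_act i'M iM r'E.
pose sw (Y Y' : Type) (y : Y * Y') := (y.2, y.1).
have swK Y Y' : cancel (@sw Y Y') (@sw Y' Y) by case.
pose c x' : bijection (X * X') := @Bijection _
  (fun y => sw _ _ (b x' (sw _ _ y))) (fun y => sw _ _ (bij_inv (b x') (sw _ _ y)))
  (fun y => etrans (congr1 _ (etrans (congr1 _ (swK _ _ _)) (bij_funK _ _))) (swK _ _ y))
  (fun y => etrans (congr1 _ (etrans (congr1 _ (swK _ _ _)) (bij_invK _ _))) (swK _ _ y)).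
exists (bijection (X * X')), a, c; split=> //.
- by move=> x y; apply: bijectionP => z; rewrite bij_mulE /= bM swK.
- move=> x y e; apply: b_inj; apply: bijectionP => z.
  have /(congr1 (fun f : bijection _ => sw _ _ (f (sw _ _ z)))) := e.
  by rewrite /= !swK.
- by move=> v; apply: bijectionP => -[y y']; rewrite aE /= bE.
Qed.

Section Wreath.
Variable X : groupType.

(** The unrestricted wreath product: coefficients will be mapped to constant functions, which have
    infinite support. *)
Definition wreath : Type := ((int -> X) * int)%type.

HB.instance Definition _ := Choice.on wreath.

Definition wr_one : wreath := (fun=> 1, 0%R).
Definition wr_mul (u v : wreath) : wreath :=
  (fun i => u.1 i * v.1 (i + u.2)%R, (u.2 + v.2)%R).
Definition wr_inv (u : wreath) : wreath :=
  (fun i => (u.1 (i - u.2)%R)^-1, (- u.2)%R).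

Fact wr_mulA : associative wr_mul.
Proof.
move=> u v w; congr (_, _); last exact: addrA.
by apply/funext => i; rewrite /= mulgA addrA.
Qed.
Fact wr_mul1g : left_id wr_one wr_mul.
Proof.
move=> [u n]; congr (_, _); last exact: add0r.
by apply/funext => i; rewrite /= mul1g addr0.
Qed.
Fact wr_mulg1 : right_id wr_one wr_mul.
Proof.
move=> [u n]; congr (_, _); last exact: addr0.
by apply/funext => i; rewrite /= mulg1.
Qed.
Fact wr_mulVg : left_inverse wr_one wr_inv wr_mul.
Proof.
move=> [u n]; congr (_, _); last exact: addNr.
by apply/funext => i; rewrite /= mulVg.
Qed.
Fact wr_mulgV : right_inverse wr_one wr_inv wr_mul.
Proof.
move=> [u n]; congr (_, _); last exact: subrr.
by apply/funext => i; rewrite /= addrK mulgV.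
Qed.

HB.instance Definition _ := isGroup.Build wreath
  wr_mulA wr_mul1g wr_mulg1 wr_mulVg wr_mulgV.

Lemma wr_mulE (u v : wreath) :
  u * v = (fun i => u.1 i * v.1 (i + u.2)%R, (u.2 + v.2)%R).
Proof. by []. Qed.

Lemma wr_invE (u : wreath) : u^-1 = (fun i => (u.1 (i - u.2)%R)^-1, (- u.2)%R).
Proof. by []. Qed.

End Wreath.

(** * Locally indicable groups *)

Definition additive_on (G : groupType) (H : set G) (th : G -> int) :=
  forall x y, H x -> H y -> th (x * y) = (th x + th y)%R.

Definition generated (G : groupType) (s : seq G) : set G :=
  smallest (@subgroup G) [set` s]%classic.

Lemma generated_subgroup (G : groupType) (s : seq G) : subgroup (generated s).
Proof.
split; first by move=> H [[]].
by move=> x y gx gy H HH; have [[_ HF] _] := HH; apply: HF; [exact: gx HH | exact: gy HH].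
Qed.

Lemma mem_generated (G : groupType) (s : seq G) x : x \in s -> generated s x.
Proof. by move=> xs H [_]; apply. Qed.

Lemma generated_min (G : groupType) (s : seq G) (H : set G) :
  subgroup H -> (forall x, x \in s -> H x) -> forall x, generated s x -> H x.
Proof. by move=> sH sub x; apply; split. Qed.

Section AdditiveOn.
Variables (G : groupType) (H : set G) (th : G -> int).
Hypotheses (sH : subgroup H) (thD : additive_on H th).

Lemma additive_on1 : th 1 = 0%R.
Proof.
have H1 := subgroup1 sH; have := thD H1 H1; rewrite mulg1 => e.
by apply: (addrI (th 1)); rewrite addr0 -e.
Qed.

Lemma additive_onV x : H x -> th x^-1 = (- th x)%R.
Proof.
move=> Hx; have := thD (subgroupV sH Hx) Hx.
by rewrite mulVg additive_on1 => /eqP; rewrite eq_sym addr_eq0 => /eqP.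
Qed.

Lemma additive_on_kernel : subgroup (fun x => H x /\ th x = 0%R).
Proof.
split; first by split; [apply: subgroup1 sH | apply: additive_on1].
move=> x y [Hx x0] [Hy y0]; have HVy := subgroupV sH Hy.
by split; [apply: subgroupM | rewrite thD // additive_onV // x0 y0 subr0].
Qed.

End AdditiveOn.

(* Weakens [locally_indicable]: the homomorphism is only asked to be non-trivial, which
   spares dividing by a generator of its image in each closure property. *)
Definition indicable (G : groupType) := forall s : seq G,
  (exists2 x, x \in s & x != 1) ->
  exists th, additive_on (generated s) th /\ exists2 x, x \in s & th x != 0%R.

(** If [f] killed every generator, it would kill the whole subgroup and miss [1]. *)
Lemma locally_indicableW (G : groupType) : locally_indicable G -> indicable G.
Proof.
move=> li s [x xs x1].
have [||f [fD fE]] := li (generated s) (generated_subgroup s).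
- by exists s.
- move=> e; have := mem_generated xs; rewrite e => /= x1'.
  by move: x1; rewrite x1' eqxx.
exists f; split=> //; apply: contrapT => f0.
have sub : forall y, generated s y -> generated s y /\ f y = 0%R.
  apply: generated_min; first exact: additive_on_kernel (generated_subgroup s) fD.
  move=> y ys; split; first exact: mem_generated.
  by apply: contrapT => /eqP fy; apply: f0; exists y.
have : ([set: int]%classic 1%R) by [].
by rewrite -fE => -[y /sub[_ ->]].
Qed.

(** [p] is multiplicative on [K] only: in a wreath product it will be a coordinate, a homomorphism
    just on the base. *)
Lemma indicable_image (G H : groupType) (K : set G) (p : G -> H) (s : seq G) x :
  subgroup K -> (forall y, y \in s -> K y) ->
  (forall y z, K y -> K z -> p (y * z) = p y * p z) ->
  indicable H -> x \in s -> p x != 1 ->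
  exists th, additive_on (generated s) th /\ exists2 y, y \in s & th y != 0%R.
Proof.
move=> sK Ks pM iH xs px1; have K1 := subgroup1 sK.
have p1 : p 1 = 1 by apply: (mulIg (p 1)); rewrite -pM // !mul1g.
have pV y : K y -> p y^-1 = (p y)^-1.
  by move=> Ky; apply: (mulIg (p y)); rewrite -pM ?mulVg //; apply: subgroupV.
have [|th [thD [u us thu]]] := iH (map p s); first by exists (p x); rewrite ?map_f.
have gen y : generated s y -> K y /\ generated (map p s) (p y).
  have sg := generated_subgroup (map p s); move: y.
  apply: generated_min => [|y ys]; last first.
    by split; [apply: Ks | apply: mem_generated; rewrite map_f].
  split=> [|y z [Ky gy] [Kz gz]]; first by rewrite p1; split=> //; apply: (subgroup1 sg).
  have KVz := subgroupV sK Kz; split; first exact: subgroupM.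
  by rewrite pM // pV //; exact: (subgroupM sg gy (subgroupV sg gz)).
exists (th \o p); split; last by move: us thu => /mapP[y ys ->] thy; exists y.
by move=> y z /gen[Ky gy] /gen[Kz gz]; rewrite /= pM // thD.
Qed.

Lemma subgroupT (G : groupType) : subgroup (fun _ : G => True).
Proof. by []. Qed.

Lemma indicable_prod (G H : groupType) : indicable G -> indicable H -> indicable (G * H)%type.
Proof.
move=> iG iH s [x xs x1].
have [x11|x11] := eqVneq x.1 1.
  apply: (indicable_image (p := snd) (subgroupT _) _ _ iH xs) => //.
  by apply: contraNneq x1 => x21; rewrite [x]surjective_pairing x11 x21.
exact: (indicable_image (p := fst) (subgroupT _) _ _ iG xs).
Qed.

(** * Words and the free product with a free group *)

Definition sgn (X : groupType) (t : X) (b : bool) : X := if b then t else t^-1.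

Definition ev (C X : groupType) (E : Type) (f : C -> X) (e : E -> X) (w : seq (C * E)) : X :=
  foldr (fun p x => f p.1 * (e p.2 * x)) 1 w.

Definition letter (X : groupType) (tau : int -> X) (p : int * bool) : X := sgn (tau p.1) p.2.

(* The words of [seq (C * (int * bool))] stand for products [c1 t_{i1}^e1 c2 t_{i2}^e2 ...];
   [compatible] forbids the subwords [t_i^e 1 t_i^-e]. *)
Definition compatible (C : groupType) (I : eqType) (x y : C * (I * bool)) : bool :=
  ~~ [&& x.2.1 == y.2.1, x.2.2 != y.2.2 & y.1 == 1].

Section Eval.
Variables (C X : groupType) (E : Type) (f : C -> X) (e : E -> X).

Lemma ev_cons p w : ev f e (p :: w) = f p.1 * (e p.2 * ev f e w). Proof. by []. Qed.

Lemma ev_cat w1 w2 : ev f e (w1 ++ w2) = ev f e w1 * ev f e w2.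
Proof. by elim: w1 => [|p w1 IH] /=; rewrite ?mul1g // IH !mulgA. Qed.

Lemma ev_rot n w : ev f e w = 1 -> ev f e (rot n w) = 1.
Proof.
move=> e1; rewrite /rot ev_cat; have := e1; rewrite -{1}(cat_take_drop n w) ev_cat.
by move/mulg1_eq => <-; rewrite mulVg.
Qed.

Lemma ev_hom (Z : groupType) (a : X -> Z) w : hom a -> ev (a \o f) (a \o e) w = a (ev f e w).
Proof. by move=> aM; elim: w => [|p w IH] /=; rewrite ?(hom1 aM) // IH !aM. Qed.

End Eval.

Lemma eq_ev (C X : groupType) (E : eqType) (f f' : C -> X) (e e' : E -> X) w :
  {in map fst w, f =1 f'} -> {in map snd w, e =1 e'} -> ev f e w = ev f' e' w.
Proof.
elim: w => //= p w IH ff' ee'; rewrite ff' ?ee' ?mem_head // IH // => x xw.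
  by apply: ff'; rewrite inE xw orbT.
by apply: ee'; rewrite inE xw orbT.
Qed.

Lemma hom_letter (X Z : groupType) (a : X -> Z) (tau : int -> X) p :
  hom a -> letter (a \o tau) p = a (letter tau p).
Proof. by case: p => i [] aM //=; rewrite /letter /= (homV aM). Qed.

Lemma ev_letter_hom (C X Z : groupType) (a : X -> Z) (f : C -> X) tau w :
  hom a -> ev (a \o f) (letter (a \o tau)) w = a (ev f (letter tau) w).
Proof.
move=> aM; rewrite -ev_hom //; congr (ev _ _ _); apply/funext => p; exact: hom_letter.
Qed.

(** * The free product with a free group, in Magnus form *)

Section FreeExtension.
Variable C : groupType.

Implicit Types (w : seq (C * int)) (g h : seq (C * int) -> int) (y : C * int).

(** The letter [(c, i)] stands for the conjugate [c t_i c^-1]. These conjugates freely generate the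
    kernel of the projection to [C] that kills all [t_i], and [C] permutes them by translation. *)
Definition tr_letter (c : C) y : C * int := (c * y.1, y.2).
Definition tr_word c w := map (tr_letter c) w.
Definition tr c g w := g (tr_word c^-1 w).

Lemma tr_word1 w : tr_word 1 w = w.
Proof. by rewrite /tr_word map_id_in // => -[c i] _; rewrite /tr_letter mul1g. Qed.

Lemma tr_wordM a b w : tr_word (a * b) w = tr_word a (tr_word b w).
Proof. by rewrite /tr_word -map_comp; apply: eq_map => -[c i]; rewrite /tr_letter /= mulgA. Qed.

Lemma tr1 g : tr 1 g = g.
Proof. by apply/funext => w; rewrite /tr invg1 tr_word1. Qed.

Lemma trM a b g : tr (a * b) g = tr a (tr b g).
Proof. by apply/funext => w; rewrite /tr invgM tr_wordM. Qed.

(* On formal power series in the non-commuting letters [C * int], [tp y] is the left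
   multiplication by [1 + y], as in the Magnus embedding, and [tm y] is its inverse. *)
Definition tp y g w : int := if w is y' :: w' then (g w + if y' == y then g w' else 0)%R else g w.

Fixpoint tm y g w {struct w} : int :=
  if w is y' :: w' then (g w - if y' == y then tm y g w' else 0)%R else g w.

Lemma tpK y : cancel (tp y) (tm y).
Proof.
move=> g; apply/funext; elim=> //= y' w IH; case: eqP => _; rewrite ?IH; lia.
Qed.

Lemma tmK y : cancel (tm y) (tp y).
Proof. move=> g; apply/funext => -[] //= y' w; case: eqP => _; lia. Qed.

Definition M := seq (C * int) -> int.

Definition bij_tr : C -> bijection M := act_bij tr1 trM.
Definition bij_t y : bijection M := Bijection (tpK y) (tmK y).

Definition free_const (c : C) : bijection M * C := (bij_tr c, c).
Definition free_var (i : int) : bijection M * C := (bij_t (1, i), 1).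

Lemma free_constM : hom free_const.
Proof. by move=> a b; congr (_, _); apply: act_bijM. Qed.

Local Notation evF := (ev free_const (letter free_var)).

Definition tb y (b : bool) := if b then tp y else tm y.

Definition sg (b : bool) : int := if b then 1%R else (-1)%R.

Lemma tb_neq y b g w : (if w is y' :: _ then y' != y else true) -> tb y b g w = g w.
Proof. by case: b w => [] [|y' w] //= /negbTE ->; lia. Qed.

(** As [w] does not begin with [y], only the terms [1] and [-y] of the inverse [1 - y + y^2 - ...]
    reach [y :: w]. *)
Lemma tb_eq y b g w : (if w is y' :: _ then y' != y else true) ->
  tb y b g (y :: w) = (g (y :: w) + sg b * g w)%R.
Proof.
move=> yw; case: b => /=; rewrite eqxx; first by lia.
by rewrite (tb_neq false g yw : tm y g w = g w) mulN1r.
Qed.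

(** Such a word takes at most one letter from each block [(1 + y)^k] of a product, which keeps its
    coefficient under control. *)
Definition neq_sorted w := sorted (fun a b => a != b) w.

Lemma neq_sorted_tr c w : neq_sorted (tr_word c w) = neq_sorted w.
Proof.
rewrite /neq_sorted sorted_map; case: w => //= y w; apply: eq_path => a b /=.
rewrite /tr_letter; apply/idP/idP; apply: contraNN => /eqP.
  by move=> ->.
by case: a b => a i [b j] [] /= /mulgI -> ->.
Qed.

Lemma neq_sorted_cons y w :
  neq_sorted (y :: w) = (if w is y' :: _ then y' != y else true) && neq_sorted w.
Proof. by case: w => //= y' w; rewrite eq_sym. Qed.

(* [y :: w] is the longest block word of [h]; the sign of [h (y :: w) / h w] is that of
   the exponent of the outermost block. *)
Definition leading h y b w :=
  [/\ neq_sorted (y :: w), (sg b * (h (y :: w) * h w) > 0)%R &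
      forall v, neq_sorted v -> size w < size v -> h v != 0%R ->
        size v = (size w).+1 /\ head y v = y].

Definition delta w : int := if w is [::] then 1%R else 0%R.

Lemma leading_tr c h y b w :
  leading h y b w -> leading (tr c h) (tr_letter c y) b (tr_word c w).
Proof.
have trK v : tr c h (tr_word c v) = h v by rewrite /tr -tr_wordM mulVg tr_word1.
move=> [ns pos top]; split.
- by rewrite -[_ :: _]/(tr_word c (y :: w)) neq_sorted_tr.
- by rewrite -[_ :: _]/(tr_word c (y :: w)) !trK.
move=> v nv; rewrite size_map => sv hv.
have [||//|] := top (tr_word c^-1 v); rewrite ?neq_sorted_tr // ?size_map //.
case: v {sv hv nv} => //= a v -> e; split=> //.
by rewrite -e; case: a {e} => a i; rewrite /tr_letter /= mulVKg.
Qed.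

Lemma leading_delta y b : leading (tb y b delta) y b [::].
Proof.
split=> //; first by rewrite tb_eq // tb_neq //=; case: b.
case=> // y' v nv _; rewrite neq_sorted_cons in nv.
case: (eqVneq y' y) nv => [->|yy'] /andP[nv _]; last by rewrite tb_neq.
by rewrite tb_eq //; case: v nv => //= a v _; rewrite mulr0.
Qed.

(** The outer block grows: [h (y :: w)] changes by [sg b * h w], so the sign condition moves it away
    from zero. *)
Lemma leading_same h y b w : leading h y b w -> leading (tb y b h) y b w.
Proof.
move=> [ns pos top]; have := ns; rewrite neq_sorted_cons => /andP[yw nw].
split=> //.
  rewrite tb_eq // tb_neq //.
  by move: (h w) (h _) pos => p q; case: (b) => /=; nia.
case=> // y' v nv sv; have := nv; rewrite neq_sorted_cons => /andP[yv nv'].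
case: (eqVneq y' y) yv nv => [->|yy'] yv nv; last by rewrite tb_neq //; apply: top.
rewrite tb_eq // => hv; split=> //.
have [e|] := eqVneq (h (y :: v)) 0%R; last by case/(top _ nv).
have [e'|hv'] := eqVneq (h v) 0%R; first by rewrite e e' mulr0 in hv.
rewrite ltnS leq_eqVlt in sv; case/orP: sv => [/eqP ->|sv] //.
have [_] := top _ nv' sv hv'.
by case: v yv sv {nv nv' hv hv' e} => //= a v ay _ e; rewrite e eqxx in ay.
Qed.

(** A block opens: [h] vanishes on block words of length [size w + 2], so the new coefficient is
    exactly [sg b * h (y1 :: w)]. *)
Lemma leading_new h y b y1 b1 w :
  y1 != y -> leading h y1 b1 w -> leading (tb y b h) y b (y1 :: w).
Proof.
move=> y1y [ns pos top].
have h0 v : neq_sorted v -> (size w).+1 < size v -> h v = 0%R.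
  move=> nv sv; apply: contrapT => /eqP /(top v nv (ltnW sv)) [e _].
  by rewrite e ltnn in sv.
have ns' : neq_sorted (y :: y1 :: w) by rewrite neq_sorted_cons y1y.
split=> //.
  rewrite tb_eq // tb_neq // h0 //= add0r.
  have {pos} : h (y1 :: w) != 0%R by apply: contraTneq pos => ->; rewrite mul0r mulr0 ltxx.
  by move: (h _) => p; case: (b) => /=; nia.
case=> // y' v nv sv; have := nv; rewrite neq_sorted_cons => /andP[yv nv'].
case: (eqVneq y' y) yv nv => [->|yy'] yv nv; last by rewrite tb_neq // h0.
rewrite tb_eq // h0 // add0r => hv; split=> //.
have {}hv : h v != 0%R by apply: contraNneq hv => ->; rewrite mulr0.
by have [/= -> _] := top _ nv' sv hv.
Qed.

Lemma leading_reduced c i b L : sorted (@compatible C int) ((c, (i, b)) :: L) ->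
  exists w, leading (bij_inv (bij_tr c) ((evF ((c, (i, b)) :: L)).1 delta)) (1, i) b w.
Proof.
have E d j e K : bij_inv (bij_tr d) ((evF ((d, (j, e)) :: K)).1 delta) =
    tb (1, j) e ((evF K).1 delta).
  rewrite ev_cons; move: (evF K) => q.
  by case: e; [exact: (bij_funK (bij_tr d) (tp _ (q.1 _)))
              |exact: (bij_funK (bij_tr d) (tm _ (q.1 _)))].
elim: L c i b => [|[c' [i' b']] L IH] c i b; rewrite E.
  by move=> _; exists [::]; apply: leading_delta.
move=> /andP[ok sL]; have {IH} [w] := IH c' i' b' sL.
set h := bij_inv _ _ => /(leading_tr c').
have -> : tr c' h = (evF ((c', (i', b')) :: L)).1 delta by exact: (bij_invK (bij_tr c') _).
move: (evF _) => {h sL} q lead.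
(* Equality means that the coefficient between two occurrences of [t_i] is [1]; then [compatible]
   makes their exponents equal and the block grows. *)
have [e|ne] := eqVneq (c', i') (1, i).
  exists (tr_word c' w); apply: leading_same; move: lead ok.
  rewrite /tr_letter /= mulg1 /compatible /= e; case: e => -> ->; rewrite !eqxx andbT /=.
  by rewrite negbK => lead /eqP ->.
exists (tr_letter c' (1, i') :: tr_word c' w); apply: leading_new lead.
by rewrite /tr_letter /= mulg1.
Qed.

(** The identity would fix [delta], which vanishes at non-empty words, whereas the leading
    coefficient of a reduced word does not. *)
Lemma reduced_neq1 p L c : sorted (@compatible C int) (p :: L) ->
  evF (p :: L) * free_const c <> 1.
Proof.
case: p => c' [i b] /leading_reduced[w [ns pos _]] /(congr1 (fun x : bijection M * C => x.1 (@delta))).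
have dK d : bij_tr d delta = delta by apply/funext => -[].
have -> : (evF ((c', (i, b)) :: L) * free_const c).1 delta = (evF ((c', (i, b)) :: L)).1 delta.
  by rewrite -[in RHS](dK c).
move=> e; move: pos; rewrite e.
have -> : bij_inv (bij_tr c') ((1 : bijection M * C).1 delta) = delta := dK c'^-1.
by rewrite mul0r mulr0 ltxx.
Qed.

End FreeExtension.

(* A pair [(w, c)] stands for the product of [w] followed by [c]. *)
Definition wval (C X : groupType) (f : C -> X) (tau : int -> X)
    (u : seq (C * (int * bool)) * C) : X :=
  ev f (letter tau) u.1 * f u.2.

Definition wmul (C : groupType) (u v : seq (C * (int * bool)) * C) :=
  if v.1 is p :: w then (u.1 ++ (u.2 * p.1, p.2) :: w, v.2) else (u.1, u.2 * v.2).

Fixpoint winv (C : groupType) (w : seq (C * (int * bool))) (d : C) :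
    seq (C * (int * bool)) * C :=
  if w is (c, (i, b)) :: w' then wmul (wmul (winv w' d) ([:: (1, (i, ~~ b))], 1)) ([::], c^-1)
  else ([::], d^-1).

Definition supported (C : Type) (P : pred int) (w : seq (C * (int * bool))) :=
  all (fun p => P p.2.1) w.

Section WordValues.
Variables (C X : groupType) (f : C -> X) (tau : int -> X).
Hypothesis fM : hom f.

Lemma sgnN (t : X) b : sgn t (~~ b) = (sgn t b)^-1.
Proof. by case: b; rewrite //= invgK. Qed.

Lemma wval_mul u v : wval f tau (wmul u v) = wval f tau u * wval f tau v.
Proof.
case: v => -[|p w] d; rewrite /wmul /wval /=; first by rewrite mul1g fM mulgA.
by rewrite ev_cat /= fM !mulgA.
Qed.

Lemma wval_inv w d : wval f tau (winv w d) = (wval f tau (w, d))^-1.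
Proof.
elim: w => [|[c [i b]] w IH] /=; first by rewrite /wval /= !mul1g (homV fM).
rewrite !wval_mul IH {2 3 4}/wval /= /letter /= sgnN (hom1 fM) (homV fM).
by rewrite -!mulgA !invgM !mul1g -!mulgA.
Qed.

Lemma wval_nil c : wval f tau ([::], c) = f c. Proof. exact: mul1g. Qed.

Lemma wval_var i b : wval f tau ([:: (1, (i, b))], 1) = letter tau (i, b).
Proof. by rewrite /wval /= (hom1 fM) mul1g !mulg1. Qed.

End WordValues.

Lemma supported_mul (C : groupType) P (u v : seq (C * (int * bool)) * C) :
  supported P u.1 -> supported P v.1 -> supported P (wmul u v).1.
Proof.
case: v => -[|p w] d //=; rewrite /wmul /supported /= => hu hv.
by rewrite all_cat hu.
Qed.

Lemma supported_inv (C : groupType) P (w : seq (C * (int * bool))) (d : C) :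
  supported P w -> supported P (winv w d).1.
Proof.
elim: w => // -[c [i b]] w IH /andP[Pi sw].
apply: supported_mul => //; apply: supported_mul; first exact: IH.
exact/andP.
Qed.

Lemma supported_subgroup (C X : groupType) (f : C -> X) (tau : int -> X) (P : pred int) :
  hom f -> subgroup (fun x => exists2 u, supported P u.1 & x = wval f tau u).
Proof.
move=> fM; split; first by exists ([::], 1); rewrite // wval_nil (hom1 fM).
move=> x y [u su ->] [[w d] sv ->]; exists (wmul u (winv w d)).
  by apply: supported_mul => //; apply: supported_inv.
by rewrite wval_mul // wval_inv.
Qed.

(** * Indicability of the free extension *)

Section FreeIndicable.
Variable C : groupType.
Hypothesis iC : indicable C.

Implicit Types (w : seq (C * int)) (g h : M C).

Definition vanish n g := forall w, size w < n -> g w = 0%R.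

(** For a trivial [C]-component this is unipotence: [x] acts as the identity on each graded piece of
    the filtration by [vanish]. *)
Definition triangular (x : bijection (M C) * C) :=
  (forall g h, x.1 (fun w => g w + h w)%R = (fun w => x.1 g w + x.1 h w)%R) /\
  forall n g, vanish n g -> vanish n.+1 (fun w => x.1 g w - tr x.2 g w)%R.

Lemma vanish_tr n c g : vanish n g -> vanish n (tr c g).
Proof. by move=> vg w sw; apply: vg; rewrite size_map. Qed.

Lemma triangular_vanish x n g : triangular x -> vanish n g -> vanish n (x.1 g).
Proof.
move=> [_ xT] vg w sw.
by have := xT _ _ vg w (ltnW sw); rewrite (vanish_tr _ vg sw) subr0.
Qed.

Lemma triangular_mul x y : triangular x -> triangular y -> triangular (x * y).
Proof.
move=> tx ty; have [xD xT] := tx; have [yD yT] := ty; split.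
  by move=> g h; rewrite /= -xD -yD.
move=> n g vg w sw.
pose h := (fun w => y.1 g w - tr y.2 g w)%R.
have e : y.1 g = (fun w => h w + tr y.2 g w)%R by apply/funext => v; rewrite /h subrK.
have -> : (x * y).1 g = x.1 (y.1 g) by [].
have -> : tr (x * y).2 g = tr x.2 (tr y.2 g) := trM _ _ _.
have vh := triangular_vanish tx (yT n g vg).
have := xT _ _ (vanish_tr y.2 vg) w sw.
rewrite e xD (vh w sw); lia.
Qed.

Lemma triangular_const c : triangular (free_const c).
Proof. by split=> // n g vg w sw; rewrite /= subrr. Qed.

Lemma triangular_tb y b : triangular (sgn (bij_t y) b, 1).
Proof.
have tbE g w : (sgn (bij_t y) b) g w = tb y b g w by case: b.
have tbD g h w : tb y b (fun w => g w + h w)%R w = (tb y b g w + tb y b h w)%R.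
  case: (b) => /=; first by case: w => //= y' w; case: eqP => _; lia.
  by elim: w => //= y' w ->; case: eqP => _; lia.
split; first by move=> g h; apply/funext => w; rewrite !tbE tbD.
move=> n g vg; rewrite /= tr1 => -[|y' w] sw; rewrite !tbE; first by case: (b); rewrite /= subrr.
case: (b) => /=.
  by case: eqP => _; rewrite ?(vg w) //; lia.
suff -> : tm y g w = 0%R by case: eqP => _; lia.
elim: w n vg sw => [|y1 w IH] n vg sw /=; first by apply: vg.
rewrite (vg (y1 :: w)) // (IH n vg); last exact: ltnW.
by case: eqP.
Qed.

Lemma triangular_wval u : triangular (wval (@free_const C) (@free_var C) u).
Proof.
case: u => w c; apply: triangular_mul (triangular_const c).
elim: w => [|[d [i b]] w IH].
  have -> : ev (@free_const C) (letter (@free_var C)) [::] = free_const 1.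
    by rewrite (hom1 (@free_constM C)).
  exact: triangular_const.
rewrite ev_cons; apply: triangular_mul (triangular_const d) _.
apply: triangular_mul IH; rewrite /letter.
have -> : sgn (free_var C (i, b).1) (i, b).2 = (sgn (bij_t (1, i)) b, 1).
  by case: b => //=; congr (_, _); rewrite invg1.
exact: triangular_tb.
Qed.

Definition free_set : set (bijection (M C) * C) :=
  fun x => exists2 u, supported xpredT u.1 & x = wval (@free_const C) (@free_var C) u.

Lemma free_subgroup : subgroup free_set.
Proof. exact/supported_subgroup/free_constM. Qed.

Definition free_ext := subgroup_type free_subgroup.

Lemma free_ext_triangular (x : free_ext) : triangular (sg_val x).
Proof. by have [u _ ->] := sg_prop x; apply: triangular_wval. Qed.

(* The additive function extracted from the filtration of [M C] by word length:
   where all of [s] acts as the identity modulo words longer by [n], the components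
   raising the length by exactly [n] are additive. *)
Lemma free_ext_indicable : indicable free_ext.
Proof.
move=> s s1.
pose pr (x : free_ext) := (sg_val x).2.
have [[x xs prx]|/forallPNP pr1] := pselect (exists2 x, x \in s & pr x != 1).
  exact: (indicable_image (p := pr) (subgroupT _) _ _ iC xs).
pose act (x : free_ext) : M C -> M C := (sg_val x).1.
pose filt n x := forall l g, vanish l g -> vanish (l + n) (fun w => act x g w - g w)%R.
have {}pr1 x : x \in s -> pr x = 1 by move=> /pr1 /negP; rewrite negbK => /eqP.
have filt1 x : pr x = 1 -> filt 1%N x.
  move=> px l g vg; rewrite addn1; have [_ xT] := free_ext_triangular x.
  by have := xT _ _ vg; rewrite -/(pr x) px tr1.
(* A non-trivial [x] with trivial [C]-component changes some series at some word [w]; then [filt]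
   fails at [(size w).+1], with [l = 0]. *)
have ex : exists n, `[< exists2 x, x \in s & ~ filt n x >].
  have [x xs x1] := s1; apply: contrapT => nex.
  move/eqP: x1; apply; apply: sg_val_inj.
  rewrite [LHS]surjective_pairing -/(pr x) pr1 //; congr (_, _).
  apply: bijectionP => g; apply/funext => w.
  have f : filt (size w).+1 x.
    by apply: contrapT => nf; apply: nex; exists (size w).+1; apply/asboolP; exists x.
  by apply/eqP; rewrite -subr_eq0; apply/eqP; apply: (f 0).
have [n /asboolP[x xs nfx] n_min] := ex_minnP ex.
(* The least failing index becomes [n.+1], so all of [s] satisfies [filt n]; [filt1] gives
   [n > 0]. *)
case: n nfx n_min => [|n] nfx n_min.
  case: nfx => l g vg w; rewrite addn0 => sw.
  by apply: (filt1 x (pr1 x xs) l g vg); rewrite addn1 ltnW.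
have filtn y : y \in s -> filt n y.
  move=> ys; apply: contrapT => nfy; suff : n < n by rewrite ltnn.
  by apply: n_min; apply/asboolP; exists y.
have n0 : 0 < n.
  by case: n {n_min filtn} nfx => // nfx; case: nfx; apply: filt1; apply: pr1.
have [l [g [vg [w [sw gw]]]]] : exists l g, vanish l g /\
    exists w, size w = l + n /\ (act x g w - g w != 0)%R.
  apply: contrapT => nex; apply: nfx => l g vg w; rewrite addnS ltnS leq_eqVlt.
  case/orP => [/eqP sw|]; last exact: filtn.
  by apply: contrapT => /eqP gw; apply: nex; exists l, g; split=> //; exists w.
have actD y h (k : M C) : act y (fun w => h w + k w)%R = (fun w => act y h w + act y k w)%R.
  by have [+ _] := free_ext_triangular y; apply.
have actM (y z : free_ext) h : act (y * z) h = act y (act z h) by [].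
(* The cross term has order [m + n + n], beyond [m + n] since [n > 0]. *)
have filtM (y z : free_ext) : filt n y -> filt n z -> forall h m v, vanish m h -> size v <= m + n ->
    (act (y * z)%g h v - h v = (act y h v - h v) + (act z h v - h v))%R.
  move=> fy fz h m v vh sv.
  pose k := (fun w => act z h w - h w)%R.
  have e : act z h = (fun w => k w + h w)%R by apply/funext => v'; rewrite /k subrK.
  have vk : vanish (m + n) k := fz m h vh.
  rewrite actM e actD; have := fy _ _ vk v.
  have -> : size v < m + n + n by rewrite (leq_ltn_trans sv) // -[X in X < _]addn0 ltn_add2l.
  by move/(_ isT); lia.
exists (fun y => act y g w - g w)%R; split; last by exists x.
have gen : forall y, generated s y -> filt n y.
  apply: generated_min => // {filtn}.
  have filtV y : filt n y -> filt n y^-1.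
    move=> fy m h vh v sv.
    pose k := act y^-1 h.
    have vk : vanish m k := triangular_vanish (free_ext_triangular y^-1) vh.
    have e : act y k = h by rewrite /k -actM mulgV.
    by have := fy m k vk v sv; rewrite e -/k; lia.
  split; first by move=> m h vh v sv; rewrite /act /= subrr.
  move=> y z fy /filtV fz m h vh v sv.
  by rewrite (filtM _ _ fy fz h m) ?(ltnW sv) // (fy m) // (fz m).
by move=> y z /gen fy /gen fz; apply: (filtM _ _ fy fz g l) => //; rewrite sw.
Qed.

End FreeIndicable.

(** Characterises by normal forms the free product of [C] with the free group on the [t i], so that
    power series can be forgotten. *)
Record free_over (C U : groupType) (io : C -> U) (t : int -> U) : Prop := FreeOver {
  fo_hom : hom io;
  fo_inj : forall c, io c = 1 -> c = 1;
  fo_reduced : forall p L c, sorted (@compatible C int) (p :: L) ->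
    ev io (letter t) (p :: L) * io c <> 1;
  fo_generated : forall x, exists u, x = wval io t u }.

Lemma free_extension (C : groupType) : indicable C ->
  exists (U : groupType) (io : C -> U) (t : int -> U), indicable U /\ free_over io t.
Proof.
move=> iC.
have inC (c : C) : free_set (free_const c) by exists ([::], c); rewrite // wval_nil.
have inT i : free_set (free_var C i).
  by exists ([:: (1, (i, true))], 1); rewrite // wval_var //; apply: free_constM.
pose io c : free_ext C := Subgroup (inC c); pose t i : free_ext C := Subgroup (inT i).
have evE w : sg_val (ev io (letter t) w) = ev (@free_const C) (letter (@free_var C)) w.
  by rewrite -(ev_letter_hom io t w (@sg_valM _ _ (@free_subgroup C))).
exists (free_ext C), io, t; split; first exact: free_ext_indicable.
split.
- by move=> a b; apply: sg_val_inj; apply: free_constM.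
- by move=> c /(congr1 (fun x : free_ext C => (sg_val x).2)).
- move=> p L c sL /(congr1 (@sg_val _ _)); rewrite [LHS]sg_valM evE.
  exact: reduced_neq1.
- move=> x; have [u _ xE] := sg_prop x; exists u; apply: sg_val_inj.
  by rewrite [RHS]sg_valM evE.
Qed.

(** A letter put before a reduced tail can cancel only with the first letter of the tail. The rest
    stays reduced, as [compatible] ignores the coefficient of the first letter of a word. *)
Lemma reduced_form (C : groupType) (u : seq (C * (int * bool)) * C) :
  exists2 r, sorted (@compatible C int) r.1 &
    forall (X : groupType) (f : C -> X) tau, hom f -> wval f tau r = wval f tau u.
Proof.
case: u => w d; elim: w => [|[c [i b]] w [[L e] /= sL E]]; first by exists ([::], d).
have {}E (X : groupType) (f : C -> X) tau : hom f ->
    wval f tau ((c, (i, b)) :: L, e) = wval f tau ((c, (i, b)) :: w, d).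
  by move=> fM; have := E X f tau fM; rewrite /wval /= -!mulgA => ->.
case: L sL E => [|[c1 [i1 b1]] L] sL E; first by exists ([:: (c, (i, b))], e).
have [ok|] := boolP (compatible (c, (i, b)) (c1, (i1, b1))).
  by exists ((c, (i, b)) :: (c1, (i1, b1)) :: L, e); rewrite //= ok.
rewrite negbK /= => /and3P[/eqP ei /eqP eb /eqP ec].
have b1E : b1 = ~~ b by case: (b) (b1) eb => [] [].
have {}E (X : groupType) (f : C -> X) tau : hom f ->
    f c * wval f tau (L, e) = wval f tau ((c, (i, b)) :: w, d).
  move=> fM; rewrite -E // /wval /= -ei b1E ec (hom1 fM) mul1g.
  by rewrite /letter sgnN mulVKg mulgA.
case: L sL E => [|[c2 x2] L] sL E.
  by exists ([::], c * e) => // X f tau fM; rewrite -E // !wval_nil fM.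
exists ((c * c2, x2) :: L, e) => [|X f tau fM]; last by rewrite -E // /wval /= fM !mulgA.
by case/andP: sL => _; case: (L).
Qed.

Section FreeOver.
Variables (C U : groupType) (io : C -> U) (t : int -> U).
Hypothesis fo : free_over io t.
Let ioM := fo_hom fo.

Section Lift.
Variables (X : groupType) (f : C -> X) (tau : int -> X).
Hypothesis fM : hom f.

Lemma free_over_wval1 u : wval io t u = 1 -> wval f tau u = 1.
Proof.
have [[L c] /= sL E] := reduced_form u; rewrite -!E //.
case: L sL {E} => [|p L] sL; first by rewrite !wval_nil => /(fo_inj fo) ->; apply: hom1.
by move/(fo_reduced fo sL).
Qed.

(** Each element is spelled by a chosen word; [free_over_wval1] makes the choice immaterial. *)
Lemma free_over_lift : exists2 Phi : U -> X, hom Phi & forall u, Phi (wval io t u) = wval f tau u.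
Proof.
have /choice[rep repE] x := fo_generated fo x.
have E u v : wval io t u = wval io t v -> wval f tau u = wval f tau v.
  case: v => w d e; apply: divg1_eq; rewrite -wval_inv // -wval_mul //.
  by apply: free_over_wval1; rewrite wval_mul // wval_inv // e mulgV.
exists (fun x => wval f tau (rep x)) => [x y|u]; last by apply: E; rewrite -repE.
by rewrite -wval_mul //; apply: E; rewrite wval_mul // -!repE.
Qed.

End Lift.

(** The converse of [free_over_wval1] on words in the unknowns of [P]: in [X], these unknowns and
    [C] generate their free product. *)
Definition faithful (P : pred int) (X : groupType) (f : C -> X) (tau : int -> X) :=
  forall u, supported P u.1 -> wval f tau u = 1 -> wval io t u = 1.

End FreeOver.

(** * Equations in one unknown *)

Definition compatible1 (C : groupType) (x y : C * bool) : bool :=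
  ~~ ((x.2 != y.2) && (y.1 == 1)).

Definition solvable (C : groupType) (w : seq (C * bool)) :=
  exists (H : groupType) (f : C -> H) (t : H),
    [/\ hom f, injective f & ev f (sgn t) w = 1].

Section Contract.
Variables (C U : groupType) (io : C -> U) (t : int -> U).
Hypothesis fo : free_over io t.
Variable M : int.

(* Reads a word as a word in the single variable [t M], with coefficients in [U]. *)
Fixpoint contract (acc : U) (W : seq (C * (int * bool))) : seq (U * bool) * U :=
  if W is (c, (i, b)) :: W' then
    if i == M then ((acc * io c, b) :: (contract 1 W').1, (contract 1 W').2)
    else contract (acc * (io c * letter t (i, b))) W'
  else ([::], acc).

Lemma size_contract acc W : size (contract acc W).1 = count (fun p => p.2.1 == M) W.
Proof. by elim: W acc => [|[c [i b]] W IH] acc //=; case: eqP => _; rewrite /= IH. Qed.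

Lemma ev_contract (H : groupType) (F : U -> H) (s : H) acc W : hom F ->
  ev F (sgn s) (contract acc W).1 * F (contract acc W).2 =
  F acc * ev (F \o io) (letter (fun i => if i == M then s else F (t i))) W.
Proof.
move=> FM; elim: W acc => [|[c [i b]] W IH] acc /=; first by rewrite mul1g mulg1.
rewrite /letter /=; case: eqP => _ /=.
  by rewrite FM -!mulgA IH (hom1 FM) mul1g.
rewrite IH !FM -!mulgA; congr (_ * (_ * (_ * _))).
by case: b; rewrite //= (homV FM).
Qed.

Lemma contract_rcons acc V c b : exists L x,
  contract acc (rcons V (c, (M, b))) = (rcons L (x, b), 1).
Proof.
elim: V acc => [|[c' [i b']] V IH] acc /=.
  by rewrite eqxx; exists [::], (acc * io c).
case: eqP => _; last exact: IH.
by have [L [x ->]] := IH 1; exists ((acc * io c', b') :: L), x.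
Qed.

(** [D] is what was read since the last occurrence [x] of [t M]. Between opposite exponents the new
    coefficient is the value of a reduced word, non-trivial by [fo_reduced], or by [fo_inj] if [D]
    is empty. *)
Lemma contract_path x y D W : x.2.1 = M -> y.2 = x.2.2 -> all (fun p => p.2.1 != M) D ->
  path (@compatible C int) x (D ++ W) ->
  path (@compatible1 U) y (contract (ev io (letter t) D) W).1.
Proof.
move=> xM; elim: W x y D xM => [|[c [i b]] W IH] x y D xM yx aD //=.
case: (eqVneq i M) => [->{i}|iM].
  rewrite cat_path /= => /and3P[pD ok pW]; apply/andP; split; last first.
    exact: (IH (c, (M, b)) _ [::]).
  rewrite /compatible1 /= yx; apply/nandP.
  have [_|xb] := eqVneq x.2.2 b; [by left | right].
  case: D aD pD ok => [|p D] aD pD ok.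
    apply/eqP; rewrite mul1g => /(fo_inj fo) c1; move: ok.
    by rewrite /compatible /= xM eqxx xb c1 eqxx.
  by apply/eqP/(fo_reduced fo); case/andP: pD.
rewrite -cat_rcons => pDW; have := IH _ _ _ xM yx _ pDW.
by rewrite all_rcons /= iM -cats1 ev_cat /= mulg1; apply.
Qed.

(** The equation is solved for [t M] over [U]; the other unknowns stay free because [U] embeds in
    [H]. *)
Lemma solve_for_variable (W : seq (C * (int * bool))) :
  cycle (@compatible C int) W -> has (fun p => p.2.1 == M) W ->
  (forall w : seq (U * bool), size w = count (fun p => p.2.1 == M) W ->
     cycle (@compatible1 U) w -> solvable w) ->
  exists (X : groupType) (f : C -> X) (tau : int -> X),
    [/\ hom f, ev f (letter tau) W = 1 & faithful io t (predC1 M) f tau].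
Proof.
move=> cW /hasP[p pW /eqP pM]; case/splitPr: pW cW => W1 W2 cW.
(* The rotated word ends in an occurrence of [t M], so [contract] leaves no trailing coefficient. *)
pose W' := rcons (W2 ++ W1) p.
have WE : W' = rot (size (rcons W1 p)) (W1 ++ p :: W2).
  by rewrite -cat_rcons rot_size_cat /W' -cats1 -catA cats1.
have {}cW : cycle (@compatible C int) W' by rewrite WE rot_cycle.
have -> : count (fun q => q.2.1 == M) (W1 ++ p :: W2) = count (fun q => q.2.1 == M) W'.
  by rewrite WE; apply/permP; rewrite perm_sym perm_rot.
have pW' : path (@compatible C int) p W'.
  by have : cycle (@compatible C int) (rcons (W2 ++ W1) p) := cW; rewrite -rot1_cons rot_cycle.
move=> solv.
case: p => c [i b] in pM W' WE cW pW' solv *; rewrite /= in pM; subst i.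
have [L [x LE]] := contract_rcons 1 (W2 ++ W1) c b.
have [||H [F [s [FM F_inj Fs]]]] := solv (contract 1 W').1.
- exact: size_contract.
- rewrite /W' LE.
  have := contract_path (y := (x, b)) (D := [::]) _ _ _ pW'; rewrite /W' LE /=.
  by move/(_ erefl erefl isT) => pL; rewrite -rot1_cons rot_cycle.
exists H, (F \o io), (fun i => if i == M then s else F (t i)).
split; first by move=> a a'; rewrite /= (fo_hom fo) FM.
  have := ev_contract s 1 W' FM; rewrite Fs mul1g /W' LE /= (hom1 FM) mul1g => e.
  by rewrite -[_ ++ _](rotK (size (rcons W1 (c, (M, b))))) -WE /rotr ev_rot.
case=> w d; rewrite /= => sw; rewrite /wval /=.
have -> : ev (F \o io) (letter (fun i => if i == M then s else F (t i))) w =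
    F (ev io (letter t) w).
  rewrite -ev_letter_hom //; apply: eq_ev => // -[i e] /mapP[q qw qE].
  by move/allP/(_ q qw): sw; rewrite -qE /letter /= => /negbTE ->.
by rewrite -FM -[in X in _ = X -> _](hom1 FM) => /F_inj.
Qed.

End Contract.

Definition shiftw (C : Type) (k : int) (W : seq (C * (int * bool))) :=
  [seq (p.1, (p.2.1 + k, p.2.2)%R) | p <- W].

Lemma ev_shiftw (C X : groupType) (f : C -> X) tau k W :
  ev f (letter tau) (shiftw k W) = ev f (letter (fun i => tau (i + k)%R)) W.
Proof. by elim: W => //= p W ->. Qed.

Lemma shiftwD (C : Type) (j k : int) (W : seq (C * (int * bool))) :
  shiftw j (shiftw k W) = shiftw (k + j)%R W.
Proof. by rewrite /shiftw -map_comp; apply: eq_map => p; rewrite /= addrA. Qed.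

Lemma shiftw0 (C : Type) (W : seq (C * (int * bool))) : shiftw 0%R W = W.
Proof. by elim: W => //= -[c [i b]] W ->; rewrite addr0. Qed.

Lemma seq_int_min (x : int) s : exists2 m, m \in x :: s & forall i, i \in x :: s -> (m <= i)%R.
Proof.
elim: s x => [|y s IH] x; first by exists x; rewrite ?mem_head // => i; rewrite inE => /eqP ->.
have [m ms mP] := IH y; have [xm|mx] := lerP x m.
  exists x; rewrite ?mem_head // => i; rewrite inE => /orP[/eqP -> //|/mP]; exact: le_trans.
exists m => [|i]; first by rewrite in_cons ms orbT.
rewrite inE => /orP[/eqP ->|/mP //]; exact: ltW.
Qed.

Lemma seq_int_max (x : int) s : exists2 m, m \in x :: s & forall i, i \in x :: s -> (i <= m)%R.
Proof.
have [m ms mP] := seq_int_min (- x)%R (map -%R%R s).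
exists (- m)%R => [|i si]; first by rewrite -(mem_map (@oppr_inj int)) /= opprK.
by rewrite lerNr; apply: mP; rewrite -[_ :: _]/(map -%R%R (x :: s)) map_f.
Qed.

(** * Solving all translates of the lifted equation *)

Section Chain.
Variables (C U : groupType) (io : C -> U) (t : int -> U).
Hypothesis fo : free_over io t.
Let ioM := fo_hom fo.

Lemma faithful_sub (P Q : pred int) (X : groupType) (f : C -> X) tau :
  {subset P <= Q} -> faithful io t Q f tau -> faithful io t P f tau.
Proof. by move=> PQ fQ u su; apply: fQ; apply: sub_all su => p; apply: PQ. Qed.

Lemma faithful_inj (P : pred int) (X : groupType) (f : C -> X) tau :
  hom f -> faithful io t P f tau -> injective f.
Proof.
move=> fM ft; apply: hom_inj => // c fc; apply: (fo_inj fo).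
by have := ft ([::], c) isT; rewrite !wval_nil; apply.
Qed.

Lemma faithful_shift (P : pred int) (k : int) (X : groupType) (f : C -> X) tau :
  faithful io t P f tau ->
  faithful io t (fun i => P (i - k)%R) f (fun i => tau (i - k)%R).
Proof.
move=> ft [w d] su; rewrite /wval -ev_shiftw -/(wval f tau (_, d)) => /ft.
rewrite /supported all_map => /(_ su) /(free_over_wval1 fo (fun i => t (i + k)%R) ioM).
by rewrite /wval /= -ev_shiftw shiftwD addNr shiftw0.
Qed.

Lemma solution_product (P Q : pred int) W :
  (exists (X : groupType) (f : C -> X) tau,
     [/\ hom f, ev f (letter tau) W = 1 & faithful io t P f tau]) ->
  (exists (X : groupType) (f : C -> X) tau,
     [/\ hom f, ev f (letter tau) W = 1 & faithful io t Q f tau]) ->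
  exists (X : groupType) (f : C -> X) tau,
    [/\ hom f, ev f (letter tau) W = 1, faithful io t P f tau & faithful io t Q f tau].
Proof.
move=> [X [f [tau [fM fW ft]]]] [X' [f' [tau' [f'M f'W f't]]]].
pose F c := (f c, f' c); pose T i := (tau i, tau' i).
have fstM : hom (@fst X X') by [].
have sndM : hom (@snd X X') by [].
have E1 w : (ev F (letter T) w).1 = ev f (letter tau) w by rewrite -(ev_letter_hom _ _ _ fstM).
have E2 w : (ev F (letter T) w).2 = ev f' (letter tau') w by rewrite -(ev_letter_hom _ _ _ sndM).
exists (X * X')%type, F, T; split.
- by move=> a b; rewrite /F fM f'M.
- by rewrite [LHS]surjective_pairing E1 E2 fW f'W.
- by move=> u su /(congr1 fst); rewrite /wval fstM E1; apply: ft.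
- by move=> u su /(congr1 snd); rewrite /wval sndM E2; apply: f't.
Qed.

Variables (W : seq (C * (int * bool))) (m M : int).
Hypothesis mM : (m < M)%R.
Hypothesis W_mM : supported (fun i => (m <= i <= M)%R) W.
Hypothesis base : exists (X : groupType) (f : C -> X) tau,
  [/\ hom f, ev f (letter tau) W = 1, faithful io t (predC1 m) f tau
    & faithful io t (predC1 M) f tau].

Lemma mem_shiftw (k : int) p : p \in map snd (shiftw k W) -> (m + k <= p.1 <= M + k)%R.
Proof.
case/mapP=> q /mapP[r rW ->] -> /=; move/allP: W_mM => /(_ r rW); lia.
Qed.

(* The solutions of the shifts [0..n] and of the shift [n+1] are amalgamated over the
   subgroup generated by [C] and the unknowns they have in common, which is free in both. *)
Lemma chain_solution (n : nat) : exists (X : groupType) (f : C -> X) tau,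
  [/\ hom f, forall j : nat, j <= n -> ev f (letter tau) (shiftw j W) = 1
    & faithful io t (fun i => (m + n%:Z < i)%R && (i <= M + n%:Z)%R) f tau].
Proof.
elim: n => [|n [X [f [tau [fM fW ft]]]]].
  have [X [f [tau [fM fW ft _]]]] := base; exists X, f, tau; split=> //.
    by move=> j; rewrite leqn0 => /eqP ->; rewrite shiftw0.
  by apply: faithful_sub ft => i; rewrite !inE; lia.
have [X' [f' [tau0 [f'M f'W ftm0 ftM0]]]] := base.
pose tau' (i : int) := tau0 (i - n.+1%:Z)%R.
(* Shift [n + 1] involves the unknowns [m + n + 1] to [M + n + 1]. Freeness without the last one
   makes the overlap embed; without the first one it gives the next window. *)
have ftm : faithful io t _ f' tau' := faithful_shift ftm0.
have ftM : faithful io t _ f' tau' := faithful_shift ftM0.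
have {}f'W : ev f' (letter tau') (shiftw n.+1%:Z W) = 1.
  by rewrite ev_shiftw -f'W; congr (ev _ (letter _) _); apply/funext => i; rewrite /tau' addrK.
pose P (i : int) := ((m + n%:Z < i) && (i <= M + n%:Z))%R; rewrite -/P in ft.
pose V := subgroup_type (supported_subgroup t P ioM).
have [Phi PhiM PhiE] := free_over_lift fo tau fM.
have [Phi' Phi'M Phi'E] := free_over_lift fo tau' f'M.
have ft' : faithful io t P f' tau' by apply: faithful_sub ftM => i; rewrite !unfold_in /P /=; lia.
pose i0 (v : V) := Phi (sg_val v); pose i0' (v : V) := Phi' (sg_val v).
have i0M : hom i0 by move=> x y; apply: PhiM.
have i0'M : hom i0' by move=> x y; apply: Phi'M.
have i0_inj : injective i0.
  apply: hom_inj => // v e; apply: sg_val_inj; have [u su vE] := sg_prop v.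
  by move: e; rewrite /i0 vE PhiE; apply: ft.
have i0'_inj : injective i0'.
  apply: hom_inj => // v e; apply: sg_val_inj; have [u su vE] := sg_prop v.
  by move: e; rewrite /i0' vE Phi'E; apply: ft'.
have [Z [a [a' [aM a_inj a'M a'_inj aE]]]] := amalgam_exists i0M i0_inj i0'M i0'_inj.
have aP u : supported P u.1 -> a (wval f tau u) = a' (wval f' tau' u).
  move=> su; have Vu : exists2 u', supported P u'.1 & wval io t u = wval io t u' by exists u.
  by have := aE (Subgroup Vu : V); rewrite /i0 /i0' /= PhiE Phi'E.
have aC c : a (f c) = a' (f' c) by have := aP ([::], c) isT; rewrite !wval_nil.
have aT i : P i -> a (tau i) = a' (tau' i).
  move=> Pi; have := aP ([:: (1, (i, true))], 1); rewrite !wval_var //; apply.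
  by rewrite /supported /= Pi.
(* By [aT] the branches agree on [P], so [tau2] comes from [X] up to [M + n] and from [X'] above
   [m + n]. *)
pose tau2 i := if (i <= M + n%:Z)%R then a (tau i) else a' (tau' i).
have ev2 k w : {in map snd (shiftw k w), forall p, (m + n%:Z < p.1)%R} ->
    ev (a \o f) (letter tau2) (shiftw k w) = a' (ev f' (letter tau') (shiftw k w)).
  move=> mw; rewrite -ev_letter_hom //; apply: eq_ev => [c _|p pw] /=; first exact: aC.
  rewrite /letter /= /tau2; case: ifP => // pM; rewrite aT //.
  by rewrite /P pM mw.
exists Z, (a \o f), tau2; split; first by move=> x y; rewrite /= fM aM.
  move=> j; rewrite leq_eqVlt ltnS => /orP[/eqP ->|jn].
    by rewrite ev2 ?f'W ?(hom1 a'M) // => -[i b] /mem_shiftw /=; lia.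
  rewrite -(hom1 aM) -(fW j jn) -ev_letter_hom //; apply: eq_ev => // -[i b] /mem_shiftw /= pM.
  by rewrite /letter /= /tau2 ifT //; lia.
case=> w d /= su; rewrite /wval -(shiftw0 w) ev2 => [|[i b]].
  rewrite /= aC -a'M shiftw0 -[in X in X -> _](hom1 a'M) => /a'_inj.
  by apply: (ftm (w, d)); apply: sub_all su => -[c [i b]] /=; lia.
by rewrite shiftw0 => /mapP[[c [i' b']] qw [-> _]]; move/allP: su => /(_ _ qw) /=; lia.
Qed.

Lemma window_solution (n : nat) : exists (X : groupType) (f : C -> X) tau,
  [/\ hom f, injective f & forall j : int, (`|j| <= n%:Z)%R -> ev f (letter tau) (shiftw j W) = 1].
Proof.
have [X [f [tau [fM fW ft]]]] := chain_solution (n + n).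
exists X, f, (fun i => tau (i + n%:Z)%R); split=> //; first exact: faithful_inj ft.
move=> j jn; rewrite -ev_shiftw shiftwD.
have -> : (j + n%:Z)%R = Posz (absz (j + n%:Z)%R) by lia.
by apply: fW; lia.
Qed.

(** A compactness argument: [N] collects what dies once finitely many translates are killed. It
    meets [C] trivially, because [window_solution] kills those translates and embeds [C]. *)
Lemma system_solution : exists (X : groupType) (f : C -> X) tau,
  [/\ hom f, injective f & forall j : int, ev f (letter tau) (shiftw j W) = 1].
Proof.
pose kills (n : nat) (X : groupType) (Phi : U -> X) :=
  forall j : int, (`|j| <= n%:Z)%R -> Phi (ev io (letter t) (shiftw j W)) = 1.
pose N x := exists n, forall (X : groupType) (Phi : U -> X), hom Phi -> kills n X Phi -> Phi x = 1.
have NN : normal_subset N.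
  split; first split.
  - by exists 0 => X Phi PhiM _; apply: hom1.
  - move=> x y [n nx] [k ky]; exists (maxn n k) => X Phi PhiM Kj.
    rewrite PhiM (homV PhiM) nx // ?ky // ?mulgV // => j jn; apply: Kj; lia.
  - move=> x y [n nx]; exists n => X Phi PhiM Kj.
    by rewrite conjgE !PhiM nx // mul1g (homV PhiM) mulVg.
pose Q := NormalSubgroup NN.
have pM : hom (quot_proj Q) by move=> x y; rewrite -quot_mulE.
have p1 x : quot_proj Q x = 1 <-> N x.
  split; first by rewrite -(hom1 pM) => /esym/quot_projP; rewrite invg1 mul1g.
  by move=> Nx; rewrite -(hom1 pM); apply/esym/quot_projP; rewrite invg1 mul1g.
exists (quotient_group Q), (quot_proj Q \o io), (quot_proj Q \o t); split.
- by move=> a b; rewrite /= ioM pM.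
- apply: hom_inj => [a b|c /p1[n nc]]; first by rewrite /= ioM pM.
  have [X [f [tau [fM f_inj fW]]]] := window_solution n.
  have [Phi PhiM PhiE] := free_over_lift fo tau fM.
  have evE w : Phi (ev io (letter t) w) = ev f (letter tau) w.
    by have := PhiE (w, 1); rewrite /wval (hom1 ioM) (hom1 fM) !mulg1.
  apply: f_inj; rewrite (hom1 fM) -(wval_nil f tau) -PhiE wval_nil.
  by apply: nc => // j jn; rewrite evE fW.
move=> j; rewrite ev_letter_hom //; apply/p1; exists (absz j) => X Phi PhiM; apply.
lia.
Qed.

End Chain.

(** * Lifting an equation to the infinite cyclic cover *)

Section Labels.
Variables (C : groupType) (th : C -> int) (q : int).

(* Under [c |-> th c], [t |-> q], the prefixes of [w] move a point of [int]; an occurrence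
   of [t] or [t^-1] is labelled by the lower end (for [q >= 0]) of the edge it crosses. *)
Fixpoint label (j : int) (w : seq (C * bool)) : seq (C * (int * bool)) :=
  if w is (c, b) :: w' then
    let i := (if b then j + th c else j + th c - q)%R in
    (c, (i, b)) :: label (if b then i + q else i)%R w'
  else [::].

Fixpoint total (w : seq (C * bool)) : int :=
  if w is (c, b) :: w' then (th c + ((if b then q else - q) + total w'))%R else 0%R.

Lemma size_label j w : size (label j w) = size w.
Proof. by elim: w j => [|[c b] w IH] j //=; rewrite IH. Qed.

Lemma labelK j w : [seq (p.1, p.2.2) | p <- label j w] = w.
Proof. by elim: w j => [|[c b] w IH] j //=; rewrite IH. Qed.

Lemma label_shift k j w : label (j + k)%R w = shiftw k (label j w).
Proof.
elim: w j => [|[c b] w IH] j //=; rewrite -IH.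
by case: b; congr ((_, (_, _)) :: label _ _); lia.
Qed.

(** Coordinate [j] reads the lift of [w] from base point [j]. The [- q] in the label of [t^-1] comes
    from the inverse of [(tau, q)], whose coordinates are [(tau (i - q))^-1]. *)
Lemma ev_wreath (X : groupType) (f : C -> X) (tau : int -> X) w :
  ev (fun c => (fun=> f c, th c) : wreath X) (sgn ((tau, q) : wreath X)) w =
  ((fun j => ev f (letter tau) (label j w)), total w).
Proof.
elim: w => // -[c b] w IH; rewrite ev_cons IH.
case: b; rewrite /sgn !wr_mulE; congr (_, _); apply/funext => j; rewrite /= ?wr_invE //=.
Qed.

Definition exit_position (x : C * (int * bool)) : int := (x.2.1 + if x.2.2 then q else 0)%R.

Lemma total_last x j w : j = exit_position x ->
  (j + total w)%R = exit_position (last x (label j w)).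
Proof.
elim: w x j => [|[c b] w IH] x j jx /=; first by rewrite addr0.
by rewrite -IH; case: b; rewrite /exit_position /=; lia.
Qed.

Lemma label_const0 j w : q = 0%R -> (forall p, p \in label j w -> p.2.1 = j) ->
  forall p, p \in w -> th p.1 = 0%R.
Proof.
move=> q0; elim: w => // -[c b] w IH const p.
have c0 : th c = 0%R by have /= := const _ (mem_head _ _); rewrite q0; case: (b); lia.
rewrite inE => /orP[/eqP -> //|]; apply: IH => {}p pw; apply: const.
by rewrite /= c0 q0; case: (b); rewrite ?addr0 ?subr0 inE pw orbT.
Qed.

(** Suppose all labels agree. If [q] is non-zero, the path begins and ends by crossing one edge in
    one direction, so it cannot close up. If [q = 0], constant labels kill [th] on all coefficients
    but the first, and [total] kills it there. *)
Lemma label_distinct w : total w = 0%R ->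
  (q = 0%R \/ exists c b w', [/\ w = (c, b) :: w', th c = 0%R & last b (map snd w) = b]) ->
  (exists2 p, p \in w & th p.1 != 0%R) ->
  exists p1 p2, [/\ p1 \in label 0 w, p2 \in label 0 w & p1.2.1 != p2.2.1].
Proof.
move=> tot hq [p pw /eqP thp]; apply: contrapT => const; apply: thp; move: pw.
case: w tot hq const => // -[c b] w tot hq const.
pose i : int := (if b then th c else th c - q)%R.
have {}const x : x \in label 0 ((c, b) :: w) -> x.2.1 = i.
  move=> xw; apply: contrapT => /eqP xi; apply: const.
  exists x, (c, (i, b)); split=> //.
  by rewrite /= add0r mem_head.
have q0 : q = 0%R.
  case: hq => // -[_ [_ [_ [[<- <- _] c0 lb]]]].
  (* A dummy letter whose exit position is the base point [0]. *)
  pose x0 : C * (int * bool) := (1, (0%R, false)).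
  have lx : last x0 (label 0 ((c, b) :: w)) \in label 0 ((c, b) :: w) by rewrite /= mem_last.
  have := @total_last x0 0%R ((c, b) :: w) erefl; rewrite tot addr0 /exit_position const //.
  have -> : (last x0 (label 0 ((c, b) :: w))).2.2 = b.
    rewrite -[RHS]lb -(last_map (fun p => p.2.2)).
    by rewrite -{2}(labelK 0%R ((c, b) :: w)) -map_comp.
  by rewrite /i c0; case: (b); lia.
have iE : i = th c by rewrite /i q0 subr0 if_same.
have w0 : forall p, p \in w -> th p.1 = 0%R.
  apply: (label_const0 (j := i)) => // x xw; apply: const.
  rewrite /= inE; apply/orP; right; move: xw; rewrite iE q0 add0r subr0 addr0.
  by rewrite !if_same.
have : total w = 0%R.
  elim: w w0 {tot hq const} => //= -[d e] w IH w0.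
  rewrite (w0 (d, e) (mem_head _ _)) IH => [|x xw]; last by apply: w0; rewrite inE xw orbT.
  by case: (e); rewrite q0.
move: tot => /= tot tw; rewrite inE => /orP[/eqP ->|/w0 //].
by move: tot; rewrite tw q0; case: (b) => /=; lia.
Qed.

End Labels.

(** [total (fun=> 0%R) 1 w] is the exponent sum of the unknown in [w]. *)
Lemma total_linear (C : groupType) (th th' : C -> int) (a b q : int) w :
  total (fun x => a * th x + b * th' x)%R q w =
  (a * total th 0 w + b * total th' 0 w + q * total (fun=> 0%R) 1 w)%R.
Proof. by elim: w => [|[c []] w IH] /=; rewrite ?IH; lia. Qed.

Lemma solvable_rot (C : groupType) n (w : seq (C * bool)) : solvable (rot n w) -> solvable w.
Proof.
move=> [H [f [t [fM f_inj fw]]]]; exists H, f, t; split=> //.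
by rewrite -[w](rotK n) /rotr ev_rot.
Qed.

(* The solution of the lifted system acts on the wreath product, which realises the
   cover of the relative presentation corresponding to [th]. *)
Lemma solvable_cover (C : groupType) (th : C -> int) (q : int) (w : seq (C * bool)) :
  indicable C -> additive_on (generated (map fst w)) th -> total th q w = 0%R ->
  cycle (@compatible1 C) w ->
  (exists p1 p2, [/\ p1 \in label th q 0 w, p2 \in label th q 0 w & p1.2.1 != p2.2.1]) ->
  (forall (D : groupType) (v : seq (D * bool)), indicable D ->
     0 < size v < size w -> cycle (@compatible1 D) v -> solvable v) ->
  solvable w.
Proof.
move=> iC thD tot cw [p1 [p2 [p1w p2w p12]]] IH.
set W := label th q 0 w in p1w p2w.
have cW : cycle (@compatible C int) W.
  have : cycle (@compatible1 C) [seq (p.1, p.2.2) | p <- W] by rewrite labelK.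
  rewrite cycle_map; apply: sub_cycle => x y; rewrite /= /compatible /compatible1 /=.
  by apply: contraNN => /and3P[_ -> ->].
pose idx := [seq p.2.1 | p <- W].
have idxE : idx = head 0%R idx :: behead idx by rewrite /idx; case: (W) p1w.
have [m mW m_min] := seq_int_min (head 0%R idx) (behead idx).
have [M MW M_max] := seq_int_max (head 0%R idx) (behead idx).
rewrite -idxE in mW m_min MW M_max.
have idx_mem p : p \in W -> p.2.1 \in idx by move=> pW; apply/mapP; exists p.
have i1 := idx_mem _ p1w; have i2 := idx_mem _ p2w.
have mM : (m < M)%R.
  have := m_min _ i1; have := m_min _ i2; have := M_max _ i1; have := M_max _ i2.
  by move: p12; move: (p1.2.1) (p2.2.1); lia.
have [U [io [t [iU fo]]]] := free_extension iC.
have solve k : k \in idx -> exists (X : groupType) (f : C -> X) tau,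
    [/\ hom f, ev f (letter tau) W = 1 & faithful io t (predC1 k) f tau].
  move=> /mapP[p pW kE]; apply: (solve_for_variable fo cW).
    by apply/hasP; exists p; rewrite ?kE.
  (* As [p1] and [p2] have different labels, the unknown [k] occurs fewer than [size w] times. *)
  move=> v sv cv; apply: IH cv => //; rewrite sv -has_count; apply/andP; split.
    by apply/hasP; exists p; rewrite ?kE.
  rewrite -(size_label th q 0%R w) -/W ltn_neqAle count_size andbT -all_count.
  apply/allP => /= all_k; move: p12.
  by rewrite (eqP (all_k _ p1w)) (eqP (all_k _ p2w)) eqxx.
have W_mM : supported (fun i => (m <= i <= M)%R) W.
  by apply/allP => p /idx_mem pW; rewrite m_min ?M_max.
have [X [f [tau [fM f_inj fW]]]] :=
  system_solution fo mM W_mM (solution_product (solve m mW) (solve M MW)).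
(* [th] is additive only on [V], so only [V] maps to the wreath product, which is then amalgamated
   with [C] over [V]. *)
pose V := subgroup_type (generated_subgroup (map fst w)).
pose h (c : C) : wreath X := (fun=> f c, th c).
have hM : hom (fun v : V => h (sg_val v)).
  move=> x y; rewrite wr_mulE; congr (_, _); last by apply: thD; apply: sg_prop.
  by apply/funext => i /=; apply: fM.
have h_inj : injective (fun v : V => h (sg_val v)).
  by move=> x y /(congr1 (fun u : wreath X => u.1 0%R)) /= /f_inj /sg_val_inj.
pose vl : V -> C := @sg_val _ _.
have vlM : hom vl := @sg_valM _ _ _.
have [Z [a [b [aM a_inj bM b_inj abE]]]] := amalgam_exists vlM (@sg_val_inj _ _) hM h_inj.
exists Z, a, (b ((tau, q) : wreath X)); split=> //.
rewrite -(hom1 bM); have <- : ev h (sgn ((tau, q) : wreath X)) w = 1.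
  rewrite ev_wreath tot; congr (_, _); apply/funext => j.
  by rewrite -[j]add0r label_shift fW.
rewrite -ev_hom //; apply: eq_ev => [c cw'|e _].
  by have := abE (Subgroup (mem_generated cw') : V).
by case: e; rewrite //= (homV bM).
Qed.

(** * Substituting for the unknown *)

Section Substitution.
Variables (C D : groupType) (g : C -> D) (z : D).
Hypotheses (gM : hom g) (g_inj : injective g).

(* The coefficients after writing the unknown as [t * z]; [e] is the sign of the
   preceding letter. *)
Fixpoint substw (e : bool) (w : seq (C * bool)) : seq (D * bool) :=
  if w is (c, b) :: w' then
    ((if e then z * g c else g c) * (if b then 1 else z^-1), b) :: substw b w'
  else [::].

Lemma map_snd_substw e w : map snd (substw e w) = map snd w.
Proof. by elim: w e => [|[c b] w IH] e //=; rewrite IH. Qed.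

Lemma ev_substw (H : groupType) (f : D -> H) (t : H) e w : hom f ->
  ev f (sgn t) (substw e w) * (if last e (map snd w) then f z else 1) =
  (if e then f z else 1) * ev (f \o g) (sgn (t * f z)) w.
Proof.
move=> fM; elim: w e => [|[c b] w IH] e /=; first by rewrite mul1g mulg1.
rewrite -!mulgA IH !fM; case: b => /=; rewrite ?(homV fM) ?(hom1 fM) ?mul1g ?mulg1.
  by case: e; rewrite ?fM ?mul1g -?mulgA.
by rewrite invgM; case: e; rewrite ?fM ?mul1g -?mulgA.
Qed.

(** Starting with the sign of the last letter substitutes cyclically: the new word is, up to
    conjugation, the old one at [t * f z]. *)
Lemma solvable_substw b0 w : w != [::] ->
  solvable (substw (last b0 (map snd w)) w) -> solvable w.
Proof.
move=> w0 [H [f [t [fM f_inj fw]]]]; exists H, (f \o g), (t * f z).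
split; [by move=> x y; rewrite /= gM fM | exact: inj_comp |].
have := ev_substw t (last b0 (map snd w)) w fM; rewrite fw mul1g.
have -> : last (last b0 (map snd w)) (map snd w) = last b0 (map snd w).
  by case: w w0 {fw}.
by rewrite -{1}[if _ then _ else _]mulg1 => /mulgI <-.
Qed.

Lemma path_substw x y w : x.2 = y.2 ->
  path (@compatible1 C) x w -> path (@compatible1 D) y (substw x.2 w).
Proof.
elim: w x y => [|[c b] w IH] x y xy //= /andP[ok pw]; apply/andP; split; last exact: IH pw.
move: ok; rewrite /compatible1 /= -xy; apply: contraNN => /andP[xb /eqP e]; rewrite xb.
apply/eqP/g_inj; rewrite (hom1 gM); move: e.
case: (x.2) b xb {pw} => [] [] // _; rewrite ?mulg1 //.
by move/divg1_eq; rewrite -{2}[z]mulg1 => /mulgI.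
Qed.

Lemma cycle_substw b0 w :
  cycle (@compatible1 C) w -> cycle (@compatible1 D) (substw (last b0 (map snd w)) w).
Proof.
rewrite (cycle_path (1, b0)) (cycle_path (1, b0)).
have -> : last b0 (map snd w) = (last (1, b0) w).2 by rewrite -(last_map snd).
apply: path_substw; rewrite -!(last_map snd) map_snd_substw.
by case: w.
Qed.

End Substitution.

(** * The choice of the homomorphism to the integers *)

Lemma notpath_split (T : Type) (r : rel T) x p : ~~ path r x p ->
  exists p1 y p2, p = p1 ++ y :: p2 /\ ~~ r (last x p1) y.
Proof.
elim: p x => //= y p IH x; rewrite negb_and => /orP[xy|/IH[p1 [z [p2 [-> h]]]]].
  by exists [::], y, p.
by exists (y :: p1), z, p2.
Qed.

Lemma nonalternating_rot (C : Type) (w : seq (C * bool)) :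
  ~~ cycle (fun x y => x.2 != y.2) w ->
  exists n c b w', rot n w = (c, b) :: w' /\ last b (map snd w') = b.
Proof.
case: w => // x0 w; rewrite (cycle_path x0) => notp.
have [p1 [[c b] [p2 [wE /negPn/eqP lb]]]] := notpath_split notp.
 exists (size p1), c, b, (p2 ++ p1); split.
  by rewrite wE rot_size_cat.
rewrite (last_map snd _ (c, b)) last_cat -[RHS]lb wE.
by case: p1 {wE lb} => //=; rewrite last_cat.
Qed.

Lemma indicable_wreath (C : groupType) : indicable C -> indicable (wreath C).
Proof.
move=> iC s [x xs x1].
have [[y ys y2]|/forallPNP s2] := pselect (exists2 y, y \in s & y.2 != 0%R).
  by exists snd; split; [| exists y].
have {}s2 y : y \in s -> y.2 = 0%R by move=> /s2 /negP; rewrite negbK => /eqP.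
have [i xi] : exists i, x.1 i != 1.
  apply: contrapT => nex; move/eqP: x1; apply; rewrite [LHS]surjective_pairing s2 //.
  by congr (_, _); apply/funext => i; apply: contrapT => /eqP xi; apply: nex; exists i.
have sK : subgroup (fun u : wreath C => u.2 = 0%R).
  by split=> // u v u0 v0; rewrite wr_mulE wr_invE /= u0 v0 oppr0.
apply: (indicable_image (p := fun u : wreath C => u.1 i) sK s2 _ iC xs xi).
by move=> u v u0 _; rewrite wr_mulE /= u0 addr0.
Qed.

Section Embeddings.
Variable C : groupType.

Definition wr_shift : wreath C := (fun=> 1, 1%R).
(** Conjugation by [wr_shift] moves coordinate [0] to [-1], so the two copies of [C] have disjoint
    supports and commute. *)
Definition wr_emb (b : bool) (c : C) : wreath C :=
  (fun i => if i == (if b then 0%R else (-1)%R) then c else 1, 0%R).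

Lemma wr_embM : hom (wr_emb true).
Proof.
move=> a b; rewrite wr_mulE; congr (_, _); apply/funext => i; rewrite /= addr0.
by case: eqP; rewrite ?mulg1.
Qed.

Lemma wr_emb_inj : injective (wr_emb true).
Proof. by move=> a b /(congr1 (fun u : wreath C => u.1 0%R)). Qed.

Lemma wr_emb_conj c : wr_shift * wr_emb true c * wr_shift^-1 = wr_emb false c.
Proof.
rewrite !wr_mulE wr_invE; congr (_, _); apply/funext => i /=.
rewrite invg1 mulg1 mul1g; congr (if _ then _ else _).
by apply/eqP/eqP; lia.
Qed.

Lemma substw_alternating x w : path (fun x y : C * bool => x.2 != y.2) x w ->
  substw (wr_emb true) wr_shift x.2 w = [seq (wr_emb p.2 p.1, p.2) | p <- w].
Proof.
elim: w x => [|[c b] w IH] x //= /andP[xb pw]; rewrite -(IH _ pw); congr ((_, _) :: _).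
case: (x.2) b xb {pw} => [] [] //= _; last by rewrite mulg1.
exact: wr_emb_conj.
Qed.

(** Each [t] brings one [wr_shift] along, so the shifts of the coefficients add up to the exponent
    sum. *)
Lemma total_shift e (w : seq (C * bool)) : last e (map snd w) = e ->
  total (fun u : wreath C => u.2) 0 (substw (wr_emb true) wr_shift e w) = total (fun=> 0%R) 1 w.
Proof.
suff h : forall e, (total (fun u : wreath C => u.2) 0 (substw (wr_emb true) wr_shift e w) +
    (if last e (map snd w) then 1 else 0) =
    (if e then 1 else 0) + total (fun=> 0%R) 1 w)%R.
  by move=> le; have := h e; rewrite le addrC => /addrI.
elim: w {e} => [|[c b] w IH] e /=; first by rewrite add0r addr0.
by have := IH b; case: e b => [] [] /=; lia.
Qed.

End Embeddings.

(* In the alternating case the coefficients split into two families; conjugating one of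
   them by the shift makes them commute and gives two independent maps to [int]. *)
Lemma alternating_additive (C : groupType) (w : seq (C * bool)) :
  indicable C -> 0 < size w -> cycle (@compatible1 C) w ->
  cycle (fun x y : C * bool => x.2 != y.2) w ->
  let v := [seq (wr_emb p.2 p.1, p.2) | p <- w] in
  exists th, [/\ additive_on (generated (map fst v)) th, total th 0 v = 0%R
    & exists2 p, p \in v & th p.1 != 0%R].
Proof.
move=> iC w0 cw aw v.
have coef1 : forall p, p \in w -> p.1 != 1.
  case: w w0 cw aw {v} => // x w _; rewrite !(cycle_path x).
  elim: (x :: w) (last _ _) => // y {x}w IH x /= /andP[ok pw] /andP[xy aw] p.
  rewrite inE => /orP[/eqP ->|]; last exact: IH aw p.
  by move: ok; rewrite /compatible1 xy.
have both b : exists2 p, p \in w & p.2 == b.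
  case: w w0 aw {cw v coef1} => // x w _; rewrite (cycle_path x) /= => /andP[xx _].
  have [xb|xb] := eqVneq x.2 b; first by exists x; rewrite ?mem_head ?xb.
  exists (last x w); first exact: mem_last.
  by move: xx xb; case: (x.2) (_.2) b => [] [] [].
have theta b : exists th, additive_on (generated [seq p.1 | p <- w & p.2 == b]) th /\
    exists2 p, p \in w & p.2 = b /\ th p.1 != 0%R.
  have [p pw pb] := both b.
  have [|th [thD [u us thu]]] := iC [seq p.1 | p <- w & p.2 == b].
    by exists p.1; [apply/mapP; exists p; rewrite // mem_filter pb | apply: coef1].
  exists th; split=> //; move: us thu => /mapP[q + ->].
  by rewrite mem_filter => /andP[/eqP qb qw]; exists q.
pose pos b : int := if b then 0%R else (-1)%R.
pose S b := [seq p.1 | p <- w & p.2 == b].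
pose K : set (wreath C) := fun u => u.2 = 0%R /\ forall b, generated (S b) (u.1 (pos b)).
have sK : subgroup K.
  split=> [|u u' [u0 gu] [u0' gu']].
    by split=> // b; apply: (subgroup1 (generated_subgroup (S b))).
  rewrite /K wr_mulE wr_invE /= u0 u0' oppr0 !addr0; split=> // b.
  have sg := generated_subgroup (S b).
  rewrite !addr0; exact: (subgroupM sg (gu b) (subgroupV sg (gu' b))).
have vK : forall u, generated (map fst v) u -> K u.
  apply: generated_min => // u /mapP[q /mapP[p pw ->] ->] /=; split=> //= b.
  have sg := generated_subgroup (S b).
  case: eqP => [pb|_]; last exact: (subgroup1 sg).
  apply: mem_generated; apply/mapP; exists p => //; rewrite mem_filter pw andbT.
  by move: pb; rewrite /pos; case: (p.2) (b) => [] [].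
have [th1 [th1D [p1 p1w [p1b p1t]]]] := theta true.
have [th2 [th2D [p2 p2w [p2b p2t]]]] := theta false.
have th1_1 := additive_on1 (generated_subgroup _) th1D.
pose f1 (u : wreath C) := th1 (u.1 0%R); pose f2 (u : wreath C) := th2 (u.1 (-1)%R).
have fD a b : additive_on (generated (map fst v)) (fun u => a * f1 u + b * f2 u)%R.
  move=> u u' /vK[u0 gu] /vK[_ gu']; rewrite wr_mulE /f1 /f2 /= u0 !addr0.
  rewrite th1D; [|exact: (gu true)|exact: (gu' true)].
  rewrite th2D; [|exact: (gu false)|exact: (gu' false)].
  lia.
have mem_v p : p \in w -> (wr_emb p.2 p.1, p.2) \in v.
  by move=> pw; apply/mapP; exists p.
have tot a b : total (fun u => a * f1 u + b * f2 u)%R 0 v =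
    (a * total f1 0 v + b * total f2 0 v)%R by rewrite total_linear mul0r addr0.
(* [total] imposes one linear condition on two independent maps. The combination taken when [t1]
   fails is non-zero at [p2], where [f1] vanishes. *)
have [t1|t1] := eqVneq (total f1 0 v) 0%R.
  exists (fun u => 1 * f1 u + 0 * f2 u)%R; split; rewrite ?tot ?t1 ?mul0r ?mulr0 ?addr0 //.
  exists (wr_emb p1.2 p1.1, p1.2); first exact: mem_v.
  by rewrite /= p1b mul1r mul0r addr0.
exists (fun u => total f2 0 v * f1 u + (- total f1 0 v) * f2 u)%R; split=> //.
  by rewrite tot; lia.
exists (wr_emb p2.2 p2.1, p2.2); first exact: mem_v.
by rewrite /= p2b /f1 /f2 /= th1_1 mulr0 add0r mulf_neq0 // oppr_eq0.
Qed.

Theorem equation_solvable (C : groupType) (w : seq (C * bool)) :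
  indicable C -> 0 < size w -> cycle (@compatible1 C) w -> solvable w.
Proof.
have [n] := ubnP (size w); elim: n C w => // n IHn C w.
rewrite ltnS => wn iC w0 cw.
have wN : w != [::] by case: (w) w0.
have {IHn} IH (D : groupType) (v : seq (D * bool)) : indicable D ->
    0 < size v < size w -> cycle (@compatible1 D) v -> solvable v.
  move=> iD /andP[v0 vw]; apply: IHn => //; exact: leq_trans vw wn.
have size_substw (D : groupType) (g : C -> D) z e (u : seq (C * bool)) :
    size (substw g z e u) = size u by rewrite -(size_map snd) map_snd_substw size_map.
have embM := @wr_embM C; have emb_inj := @wr_emb_inj C.
have [aw|] := boolP (cycle (fun x y : C * bool => x.2 != y.2) w).
  have [th [thD tot thv]] := alternating_additive iC w0 cw aw.
  apply: (solvable_substw (z := wr_shift C) embM emb_inj (b0 := true)) => //.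
  have cv := cycle_substw (wr_shift C) embM emb_inj true cw.
  have sv := size_substw _ (wr_emb true) (wr_shift C) (last true (map snd w)) w.
  move: cv sv.
  have -> : last true (map snd w) = (last (1, true) w).2 by rewrite -(last_map snd).
  rewrite substw_alternating -?cycle_path // => cv sv.
  apply: (solvable_cover (th := th) (q := 0%R)) => //; first exact: indicable_wreath.
    by apply: label_distinct => //; left.
  by move=> D v'; rewrite size_map; apply: IH.
move=> /nonalternating_rot[k [c [b [w' [wE lb]]]]]; apply: (solvable_rot (n := k)).
move: w0 cw IH wN size_substw; rewrite -(rot_cycle k) -(size_rot k) => _.
have -> : (w != [::]) = (rot k w != [::]) by rewrite -!size_eq0 size_rot.
rewrite wE => cw IH wN size_substw.
(* For exponent sum zero the shift component serves as [th]. It is [1] or [-1] on the first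
   coefficient, since the first and last signs agree. *)
have [sig|sig] := eqVneq (total (fun=> 0%R) 1 ((c, b) :: w')) 0%R.
  apply: (solvable_substw (z := wr_shift C) embM emb_inj (b0 := b)) => //.
  have cv := cycle_substw (wr_shift C) embM emb_inj b cw.
  rewrite /= lb in cv *.
  have tot := total_shift (e := b) (w := (c, b) :: w') lb; rewrite sig /= in tot.
  apply: (solvable_cover (th := fun u : wreath C => u.2) (q := 0%R)) => //; first exact: indicable_wreath.
    apply: label_distinct => //; [by left|].
    by eexists; [exact: mem_head|]; case: (b).
  by move=> D v'; rewrite /= size_substw; apply: IH.
(* This makes the first coefficient trivial, as [label_distinct] asks when [q] is non-zero. *)
pose z := if b then c^-1 else c.
apply: (solvable_substw (g := id) (z := z) _ _ (b0 := b)) => //.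
have cv : cycle (@compatible1 C) (substw id z b ((c, b) :: w')).
  by have := cycle_substw z (g := id) (fun _ _ => erefl) (@inj_id C) b cw; rewrite /= lb.
rewrite [last _ _]/= lb.
have vE : substw id z b ((c, b) :: w') = (1, b) :: substw id z b w'.
  by rewrite /= /z; case: (b); rewrite ?mulg1 ?mulVg ?mulgV.
set v := substw _ _ _ _ in cv vE *.
have sv : size v = (size w').+1 by rewrite /v size_substw.
have sigv : total (fun=> 0%R) 1 v != 0%R.
  have totE (u : seq (C * bool)) e : total (fun=> 0%R) 1 (substw id z e u) = total (fun=> 0%R) 1 u.
    by elim: u e => // -[d a] u IHu e; congr (_ + (_ + _))%R; apply: IHu.
  by rewrite /v totE.
(* If all coefficients are trivial, [t = 1] is a solution. *)
have [[p pv p1]|/forallPNP v1] := pselect (exists2 p, p \in v & p.1 != 1); last first.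
  exists C, id, 1; split=> //; elim: (v) v1 => // p u IHu v1.
  have /negP := v1 p (mem_head _ _); rewrite negbK => /eqP p1.
  rewrite ev_cons p1 IHu => [|x xu]; last by apply: v1; rewrite inE xu orbT.
  by case: (p.2); rewrite /= ?invg1 !mulg1.
have [|phi [phiD [u us phiu]]] := iC (map fst v).
  by exists p.1; rewrite ?map_f.
have {us} /mapP[q qv uq] := us; rewrite {}uq in phiu.
set beta := total (fun=> 0%R) 1 v in sigv.
(* Scaling by the exponent sum [beta] lets [q = - total phi 0 v] cancel the total. The summand
   [0 * 0] fits the shape of [total_linear]. *)
pose th c := (beta * phi c + 0 * 0)%R.
have thD : additive_on (generated (map fst v)) th.
  by move=> x y gx gy; rewrite /th phiD //; lia.
have th1 : th 1 = 0%R := additive_on1 (generated_subgroup _) thD.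
have tot : total th (- total phi 0 v) v = 0%R.
  by rewrite (total_linear phi (fun=> 0%R)) -/beta; lia.
apply: (solvable_cover (th := th) (q := (- total phi 0 v)%R)) => //.
  apply: label_distinct => //; last first.
    by exists q; rewrite // /th mul0r addr0 mulf_neq0.
  right; exists 1, b, (substw id z b w'); split=> //.
  by rewrite map_snd_substw.
by move=> D v'; rewrite sv; apply: IH.
Qed.

(** * The Freiheitssatz *)

Section Bundle.
Variables (G H : groupType) (f : G -> H).

Definition bundle of hom f := f.
Variable fM : hom f.

Fact bundle_is_morphism : monoid.monoid_morphism (bundle fM).
Proof. by split; [apply: hom1 | apply: fM]. Qed.

HB.instance Definition _ := isUMagmaMorphism.Build G H (bundle fM) bundle_is_morphism.

End Bundle.

Section CyclicReduction.
Variables A B : groupType.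
Implicit Types (s : seq (A + B)) (u v : free_product A B).

Definition fp_letter (x : A + B) : free_product A B :=
  match x with inl a => fp_inl a | inr b => fp_inr b end.

Lemma size_fp_cons x s : size (fp_cons x s) <= (size s).+1.
Proof.
have sr (y : A + B) r : size (reduce (y :: r)) <= (size r).+1.
  by rewrite /reduce; case: ifP.
by case: x s => [a|b] [|[c|d] s]; rewrite (leq_trans (sr _ _)) //=.
Qed.

Lemma fp_letter_cons x s (r : reduced (x :: s)) :
  FreeProduct r = fp_letter x * FreeProduct (reduced_behead r).
Proof.
apply: val_inj; have E : fp_cons x s = x :: s.
  by have := foldr_fp_cons_nil r; rewrite /= foldr_fp_cons_nil // (reduced_behead r).
by case: x r E => x r E; [rewrite [RHS]fp_inlE | rewrite [RHS]fp_inrE]; symmetry.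
Qed.

(** Conjugation by the first letter moves it to the end, where it merges with [y]. *)
Lemma rotate_shorter x s y (r : reduced (x :: rcons s y)) : same_factor x y ->
  size (FreeProduct r ^ fp_letter x) < size (FreeProduct r).
Proof.
move=> xy; have -> : size (FreeProduct r) = (size s).+2 by rewrite /= size_rcons.
rewrite (fp_letter_cons r) conjgE mulgA mulgA mulVg mul1g.
have rx : reduced [:: x] by case/andP: r => /= /andP[x1 _] _; rewrite /reduced /= x1.
have -> : fp_letter x = FreeProduct rx.
  by apply: val_inj; case: x {xy r} rx => x /andP[/= /andP[x1 _] _]; rewrite x1.
rewrite ltnS /= /mul /= -cats1 foldr_cat /=.
have s1 : size (fp_cons y [:: x]) <= 1.
  by case: x y xy {r rx} => x [] y //= _; case: ifP.
elim: s {r} => [|z s IH]; first exact: s1.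
by apply: leq_trans (size_fp_cons z _) _; rewrite ltnS.
Qed.

Definition alternating s := cycle (fun x y : A + B => ~~ same_factor x y) s.

(** Take a conjugate of minimal length. The hypotheses exclude length at most one, the empty word
    being [fp_inl 1]; ends in the same factor would give a shorter conjugate. *)
Lemma cyclically_reduced_conjugate u :
  (forall g a, u ^ g <> fp_inl a) -> (forall g b, u ^ g <> fp_inr b) ->
  exists g, alternating (u ^ g) /\ 0 < size (u ^ g).
Proof.
move=> uA uB.
have ex : exists n, `[< exists g, size (u ^ g) = n >].
  by exists (size (u ^ (1 : free_product A B))); apply/asboolP; exists (1 : free_product A B).
have [_ /asboolP[g <-] n_min] := ex_minnP ex.
have {n_min} g_min h : size (u ^ g) <= size ((u ^ g) ^ h).
  by apply: n_min; apply/asboolP; exists (g * h); rewrite conjgM.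
exists g; move: g_min (uA g) (uB g); case: (u ^ g) => -[|x s] r g_min vA vB.
  by case: (vA 1); apply: val_inj; rewrite /= eqxx.
split=> //; case: (lastP s) r g_min vA vB => [|{}s y] r g_min vA vB.
  case: x r {g_min} vA vB => x r vA vB; have := r => /andP[/= /andP[x1 _] _].
    by case: (vA x); apply: val_inj; rewrite /= x1.
  by case: (vB x); apply: val_inj; rewrite /= x1.
rewrite /alternating /= rcons_path last_rcons; have := r => /andP[_ /= ->] /=.
apply/negP => yx; have := g_min (fp_letter x).
rewrite leqNgt (rotate_shorter r) //.
by case: x y yx {r g_min vA vB} => x [] y.
Qed.

End CyclicReduction.

(* Solving the equation [prod_i a_i t b_i t^-1 = 1] over [A * B] and mapping
   [a |-> a], [b |-> b ^ (t^-1)] yields a quotient of the free product killing [u]. *)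
Theorem freiheitssatz (A B : groupType) (u : free_product A B) :
  indicable A -> indicable B ->
  (forall g a, u ^ g <> fp_inl a) -> (forall g b, u ^ g <> fp_inr b) ->
  exists (H : groupType) (Psi : free_product A B -> H),
    [/\ hom Psi, Psi u = 1 & forall a, Psi (fp_inl a) = 1 -> a = 1].
Proof.
move=> iA iB uA uB; have [g] := cyclically_reduced_conjugate uA uB.
have := fp_reduced (u ^ g); move sE : (fp_word (u ^ g)) => s.
move=> /andP[s1 _] [alt s0].
pose lt (x : A + B) : (A * B) * bool :=
  match x with inl a => ((a, 1), true) | inr b => ((1, b), false) end.
have [H [f [t [fM f_inj fw]]]] : solvable (map lt s).
  apply: equation_solvable; rewrite ?size_map //; first exact: indicable_prod.
  rewrite cycle_map; have {}s1 : all (fun x => (lt x).1 != 1) s.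
    by apply: sub_all s1 => -[] x x1; rewrite /= xpair_eqE ?eqxx ?andbT.
  case: s s1 {sE alt s0} => // x s s1; rewrite (cycle_path x).
  elim: (x :: s) (last _ _) s1 => //= {x}y {}s IH x /andP[y1 s1].
  by rewrite IH // andbT /compatible1 (negbTE y1) andbF.
have f1M : hom (fun a => f (a, 1)) by move=> a a'; rewrite -fM; congr f; congr (_, _); rewrite mulg1.
have f2M : hom (fun b => t * f (1, b) * t^-1).
  move=> b b'; rewrite !mulgA mulgVK -[in RHS](mulgA t) -fM; congr (_ * f _ * _).
  by congr (_, _); rewrite mulg1.
pose Psi := fp_lift (bundle f1M) (bundle f2M).
have PsiM : hom Psi by move=> x y; apply: gmulfM.
have Psig : Psi (u ^ g) = 1.
  (* [sg] is the [t] left open by a letter of [A] and absorbed by the next [t b t^-1]; around the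
     cycle the two ends cancel. *)
  pose sg (x : A + B) := if x is inl _ then t else 1.
  have key p r : path (fun x y : A + B => ~~ same_factor x y) p r ->
      sg p * ev f (sgn t) (map lt r) =
      foldr (fun x h => letter_lift (bundle f1M) (bundle f2M) x * h) 1 r * sg (last p r).
    elim: r p => [|x r IH] p /=; first by rewrite mul1g mulg1.
    move=> /andP[px /IH]; rewrite -mulgA => <-.
    by case: p x px => [a|b] [a'|b'] //= _; rewrite /bundle ?mul1g ?mulgA.
  rewrite /Psi /fp_lift sE; case: s s0 alt fw {sE s1} => // x s _.
  rewrite /alternating (cycle_path x) => /key + fw; rewrite fw mulg1 /=.
  by rewrite -[LHS]mul1g => /mulIg <-.
exists H, Psi; split=> //.
  by apply/eqP; rewrite -(conjg_eq1 _ (Psi g)) conjgE -(homV PsiM) -!PsiM -conjgE Psig eqxx.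
move=> a; rewrite /Psi fp_lift_inl /bundle -(hom1 fM) => /f_inj [].
by [].
Qed.

(** * Passage to the direct product with [C] *)

Theorem lemma1p4 (A B C : groupType)
    (locind_A : locally_indicable A) (locind_B : locally_indicable B)
    (w : free_product A B * C)
    (w_notin_AC : ~ exists (a : A) (c : C) (g : free_product A B * C),
       w = (fp_inl a, c) ^ g)
    (w_notin_BC : ~ exists (b : B) (c : C) (g : free_product A B * C),
       w = (fp_inr b, c) ^ g) :
  exists f : {multiplicative
      A * quotient_group (nsub_preimage pair_inr (normal_closure w))
      -> quotient_group (normal_closure w)},
    (forall (a : A) (c : C),
       f (a, quot_proj (nsub_preimage pair_inr (normal_closure w)) c) =
       quot_proj (normal_closure w) (fp_inl a, c)) /\
    injective f.
Proof.
have conj_pair (x : free_product A B) (g : free_product A B) :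
    w.1 ^ g = x -> w = (x, w.2) ^ (g^-1, 1).
  move=> <-; rewrite {1}[w]surjective_pairing -{1}(conjgK g w.1) -{1}(conjg1 w.2).
  by [].
have [|||| H [Psi [PsiM Psiw Psi_inj]]] := @freiheitssatz A B w.1.
- exact: locally_indicableW.
- exact: locally_indicableW.
- by move=> g a /conj_pair e; apply: w_notin_AC; exists a, w.2, (g^-1, 1).
- by move=> g b /conj_pair e; apply: w_notin_BC; exists b, w.2, (g^-1, 1).
pose Nw := normal_closure w; pose N := nsub_preimage pair_inr Nw.
have kerPsi x : nsub_set Nw x -> Psi x.1 = 1.
  move=> /(_ (fun x => Psi x.1 = 1)); apply; split; last by move=> _ ->.
  split; first split=> [|x1 y x0 y0]; first exact: hom1.
    by rewrite PsiM (homV PsiM) x0 y0 mulgV.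
  by move=> x1 y x0; rewrite !PsiM x0 mul1g (homV PsiM) mulVg.
pose F (x : A * quotient_group N) : quotient_group Nw := quot_proj Nw (fp_inl x.1, repr x.2).
(* Representatives of a coset of [N] differ by some [n] with [(1, n)] in the normal closure, so the
   choice made by [repr] is immaterial. *)
have FE a c : F (a, quot_proj N c) = quot_proj Nw (fp_inl a, c).
  apply/quot_projP; rewrite /=.
  have /quot_projP : quot_proj N (repr (quot_proj N c)) = quot_proj N c by apply: quot_projK.
  by rewrite /N /= /preimage /= /pair_inr; congr (nsub_set Nw _); congr (_, _); rewrite /= mulVg.
have inlM : hom (@fp_inl A B) by move=> x y; apply: gmulfM.
have FM : hom F.
  move=> [a p] [a' p'].
  have [c <-] := quot_proj_surj p; have [c' <-] := quot_proj_surj p'.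
  have -> : (a, quot_proj N c) * (a', quot_proj N c') = (a * a', quot_proj N (c * c')).
    by congr (_, _); rewrite -quot_mulE.
  rewrite !FE; have -> : (fp_inl (a * a'), c * c') = (fp_inl a, c) * (fp_inl a', c') :> free_product A B * C.
    by congr (_, _); apply: inlM.
  by rewrite -quot_mulE.
exists (bundle FM); split; first exact: FE.
move=> [a p] [a' p']; have [c <-] := quot_proj_surj p; have [c' <-] := quot_proj_surj p'.
move=> e; have {e} /quot_projP Nac : quot_proj Nw (fp_inl a, c) = quot_proj Nw (fp_inl a', c').
  by rewrite -!FE.
have aa' : a^-1 * a' = 1.
  apply: Psi_inj; rewrite -(kerPsi _ Nac) /=; congr Psi.
  by rewrite inlM (homV inlM).
have {aa'} aE : a' = a by rewrite -[a']mul1g -(mulgV a) -mulgA aa' mulg1.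
(* With equal [A]-components the two pairs differ by [(1, c^-1 * c')], and membership of this in the
   normal closure defines [N]. *)
subst a'; congr (_, _); apply/quot_projP.
by move: Nac; rewrite /N /= /preimage /= /pair_inr; congr (nsub_set Nw _); congr (_, _); rewrite /= mulVg.
Qed.
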